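(* Let $p=p(n)$ satisfy $np-\log n-\log\log n\to\infty$ as $n\to\infty$, and let $G\sim G(n,p)$. Then with high probability $r_g(G,\mathcal{H})=\delta(G)-1$.
   Context: $G(n,p)$ is the binomial random graph on $n$ labelled vertices in which each pair is an edge independently with probability $p$. ''With high probability'' means with probability tending to $1$ as $n\to\infty$. Logarithms are natural. $\mathcal{H}$ denotes the property of being Hamiltonian. For a graph $G$ and a monotone increasing graph property $\mathcal{P}$, the global resilience is $r_g(G,\mathcal{P})=\min\{m\in\mathbb{N}: \exists H\subseteq G \text{ with } e(H)=m \text{ such that } G\setminus H\notin\mathcal{P}\}$, where $G\setminus H$ is the graph on $V(G)$ with edge set $E(G)\setminus E(H)$. $\delta(G)$ is the minimum degree of $G$. *)

(* Defs.v *)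
From HB Require Import structures.
From mathcomp Require Import all_boot all_order all_algebra.

Set Implicit Arguments.
Unset Strict Implicit.
Unset Printing Implicit Defensive.

Definition vpairs (V : finType) : {set {set V}} :=
  [set e : {set V} | #|e| == 2%N].

Record sgraph (V : finType) := SGraph {
  edges : {set {set V}};
  edges_subproof : edges \subset vpairs V
}.

HB.instance Definition _ (V : finType) := [isSub for @edges V].
HB.instance Definition _ (V : finType) := [Finite of sgraph V by <:].

Definition num_edges (V : finType) (G : sgraph V) : nat := #|edges G|.

Lemma gdiff_subproof (V : finType) (G H : sgraph V) :
  edges G :\: edges H \subset vpairs V.
Proof. exact: subset_trans (subsetDl _ _) (edges_subproof G). Qed.

Definition gdiff (V : finType) (G H : sgraph V) : sgraph V :=
  SGraph (gdiff_subproof G H).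

(* Irreflexive, since [set u; u] is a singleton and hence not an edge. *)
Definition adj (V : finType) (G : sgraph V) : rel V :=
  fun u v => [set u; v] \in edges G.

Definition degree (V : finType) (G : sgraph V) (v : V) : nat :=
  #|[set u : V | adj G v u]|.

(* Every degree is smaller than #|V|, so the default value #|V| only matters
   when V is empty. *)
Definition min_degree (V : finType) (G : sgraph V) : nat :=
  \big[minn/#|V|]_(v : V) degree G v.

(* A duplicate-free closed walk of length #|V| visits every vertex once; the
   bound 3 <= #|V| excludes the degenerate cycles on at most two vertices. *)
Definition hamiltonian (V : finType) : pred (sgraph V) := fun G =>
  (3 <= #|V|)%N && [exists c : #|V|.-tuple V, ucycleb (adj G) c].

Definition breaks_by_removing (V : finType) (P : pred (sgraph V))
    (G : sgraph V) (m : nat) : bool :=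
  [exists H : sgraph V,
    [&& edges H \subset edges G, num_edges H == m & ~~ P (gdiff G H)]].

(* Only m <= num_edges G can qualify, so the minimum over all natural numbers m
   is one over 'I_(num_edges G).+1.  If P holds for the edgeless graph, there
   may be no such m and the value num_edges G is then meaningless; this never
   happens for P = hamiltonian. *)
Definition global_resilience (V : finType) (P : pred (sgraph V))
    (G : sgraph V) : nat :=
  [arg min_(m < @ord_max (num_edges G) | breaks_by_removing P G m)
     nat_of_ord m]%N.

(* Loaded only here: the classical notations [set x | P], A :\: B and the like
   would otherwise hide those of finset used above. *)
From mathcomp Require Import all_classical all_reals all_analysis.

Import Order.TTheory GRing.Theory Num.Theory.
Import numFieldNormedType.Exports.

Local Open Scope ring_scope.

Definition gnp_weight (R : realType) (n : nat) (p : R) (G : sgraph 'I_n) : R :=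
  \prod_(e in vpairs 'I_n) (if e \in edges G then p else 1 - p).

Definition gnp_prob (R : realType) (n : nat) (p : R)
    (A : pred (sgraph 'I_n)) : R :=
  \sum_(G : sgraph 'I_n | A G) gnp_weight p G.

Definition whp (R : realType) (p : nat -> R)
    (A : forall n, pred (sgraph 'I_n)) : Prop :=
  (gnp_prob (p n) (A n) @[n --> \oo] --> (1 : R))%classic.

(* Main.v *)
(* Let H consist of at most delta(G) - 2 edges of G and let F = G \ H, so that F
   has minimum degree at least 2. It suffices to show that F is Hamiltonian, since
   deleting all but one of the edges at a vertex of minimum degree destroys every
   Hamilton cycle.

   With high probability every such F contains an expander (all sets A with
   4|A| <= n have at least 2|A| neighbours outside A) with at most a small
   constant times n^2 p edges: small sets expand because G is locally sparse and
   its vertices of low degree are far apart, and the large sets are dealt with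
   by a set of O(n) edges of F meeting all large cuts. By Posa's rotations, a
   non-Hamiltonian expander E has at least n^2 / 32 boosters, pairs whose
   addition makes E Hamiltonian or lengthens its longest path. There are so few
   sparse expanders that a union bound gives each of them, in G, at least n
   boosters, and as |H| < n one of these lies in F. Adding boosters of F to the
   expander at most n times yields a Hamilton cycle of F. *)

Require Import Defs.
From mathcomp Require Import all_boot all_order all_algebra.
From mathcomp Require Import boolp reals sequences exp.
From mathcomp Require Import ring lra zify.

Set Implicit Arguments.
Unset Strict Implicit.
Unset Printing Implicit Defensive.

Import Order.TTheory GRing.Theory Num.Theory.

(** * Rotations, boosters and sparse expanders *)

(** The subgraph [H] is chosen once [G] is known, and the bounds obtained for the degree conditions
    are far too weak to survive a union bound over [H]. Hence every random event concerns [G] alone,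
    and the passage from [G] to [F] is deterministic. In particular, the edges meeting the large
    cuts are found by a greedy argument valid for any [F]: there are at most [4 ^ n] cuts and each
    contains a fixed proportion [1 / a] of the edges, so [a * (2 * n + 1)] edges suffice, a number
    in which [p] does not occur.

    The sparsity of the expander is dictated by the union bound over expanders. With [y = n * p],
    allowing [m] edges costs a factor [expR (6 * m)], while the scarcity of boosters gains
    [expR (- n * y / 60)] up to smaller terms. This leads to [m <= n * y / 1000] and to keeping only
    about [y / 2000] edges at each ordinary vertex; the constant [a] is absorbed because [y] tends
    to infinity. *)

Definition ksub (T : finType) k (A : {set T}) : {set T} :=
  [set x in take k (enum A)].

Lemma ksub_sub (T : finType) k (A : {set T}) : ksub k A \subset A.
Proof. by apply/subsetP => v; rewrite inE => /mem_take; rewrite mem_enum. Qed.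

Lemma card_ksub (T : finType) k (A : {set T}) : k <= #|A| -> #|ksub k A| = k.
Proof.
move=> kA; rewrite cardsE (card_uniqP _) ?take_uniq ?enum_uniq //.
by rewrite size_takel // -cardE.
Qed.

(** * Edge sets, paths and expanders *)

Section EdgeSets.
Variable V : finType.
Implicit Types (E F : {set {set V}}) (A B : {set V}).

(** The combinatorial part works with bare sets of edges, so that adding, deleting and joining edges
    needs no proof that a graph results; inclusion in [vpairs V] is assumed where it matters. *)
Definition adjE E : rel V := fun u v => [set u; v] \in E.

Definition nbr E A : {set V} := [set v | [exists u in A, adjE E u v]].

Definition degE E v : nat := #|[set u | adjE E v u]|.

Definition expander E : bool :=
  [forall A : {set V}, (A != set0) ==> (4 * #|A| <= #|V|) ==>
     (2 * #|A| <= #|nbr E A :\: A|)].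

(* [ham (edges G)] is convertible to [hamiltonian G]. *)
Definition ham E : bool :=
  (3 <= #|V|) && [exists c : #|V|.-tuple V, ucycleb (adjE E) c].

(** Here [k] counts vertices, not edges. *)
Definition has_path E k : bool :=
  [exists c : k.-tuple V, uniq c && sorted (adjE E) c].

(** Since [has_path] is downward closed in [k], the second alternative says that the longest path
    grows. Boosters lie outside [E] and depend on [E] only, so their presence in a random graph is
    independent of that of [E]. *)
Definition boosters E : {set {set V}} :=
  [set e in vpairs V | (e \notin E) && (ham (e |: E) ||
     [exists k : 'I_(#|V|.+1), has_path (e |: E) k && ~~ has_path E k])].

Lemma adjE_sym E u v : adjE E u v = adjE E v u.
Proof. by rewrite /adjE setUC. Qed.

Lemma pairs_neq u v : ([set u; v] \in vpairs V) = (u != v).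
Proof. by rewrite inE cards2; case: (u == v). Qed.

Lemma adjE_neq E u v : E \subset vpairs V -> adjE E u v -> u != v.
Proof. by move=> /subsetP sE /sE; rewrite pairs_neq. Qed.

Lemma adjE_sub E F : E \subset F -> subrel (adjE E) (adjE F).
Proof. by move=> /subsetP s u v /s. Qed.

Lemma nbr_sub E F A : E \subset F -> nbr E A \subset nbr F A.
Proof.
move=> s; apply/subsetP => v; rewrite !inE => /exists_inP[u uA uv].
by apply/exists_inP; exists u => //; apply: adjE_sub uv.
Qed.

Lemma expander_sub E F : E \subset F -> expander E -> expander F.
Proof.
move=> s /forallP xE; apply/forallP => A; apply/implyP => A0; apply/implyP => A4.
have /implyP/(_ A0)/implyP/(_ A4) := xE A; move/leq_trans; apply.
by apply/subset_leq_card/setSD/nbr_sub.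
Qed.

Lemma has_pathP E k :
  reflect (exists c, [/\ size c = k, uniq c & sorted (adjE E) c]) (has_path E k).
Proof.
apply: (iffP existsP) => [[c /andP[uc sc]]|[c [sc uc pc]]].
  by exists c; rewrite size_tuple.
have sc' : size c == k by rewrite sc.
by exists (Tuple sc'); rewrite /= uc.
Qed.

Lemma has_path_size E k : has_path E k -> k <= #|V|.
Proof.
by move=> /has_pathP[c [<- /card_uniqP <- _]]; apply: max_card.
Qed.

Definition longest E k := forall m, has_path E m -> m <= k.

Lemma longest_ex E (x : V) : exists2 k, has_path E k & longest E k.
Proof.
have ex : exists k, has_path E k.
  by exists 1; apply/has_pathP; exists [:: x].
exists (ex_maxn ex (@has_path_size E)); by case: ex_maxnP.
Qed.

(** * Rotations of a longest path *)

Section Posa.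
Variables (E : {set {set V}}) (x : V) (p : seq V).
Hypothesis p_path : path (adjE E) x p.
Hypothesis p_uniq : uniq (x :: p).
Hypothesis p_longest : longest E (size p).+1.

Let links (q : seq V) := pairmap pair x q.

(** Rotations with the start [x] fixed. The end is adjacent to the vertex at position [i] of
    [x :: q], which for [i = 0] is [x] itself; reversing the tail drops the link leaving that
    vertex. *)
Inductive rot_reach : seq V -> Prop :=
| RotRefl : rot_reach p
| RotStep q i of rot_reach q & i < size q &
    adjE E (last x q) (last x (take i q)) :
    rot_reach (take i q ++ rev (drop i q)).

Lemma rot_reach_inv q : rot_reach q ->
  [/\ path (adjE E) x q, perm_eq q p & uniq (x :: q)].
Proof.
elim=> [|{}q i _ [pq perm_q _] lt_i lasty]; first by split.
have perm' : perm_eq (take i q ++ rev (drop i q)) p.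
  apply: perm_trans perm_q.
  rewrite -{3}(cat_take_drop i q) perm_cat2l; exact/permPl/perm_rev.
split=> //; last first.
  have := p_uniq; rewrite /= (perm_mem perm') (perm_uniq perm'); done.
have := pq; rewrite -{1}(cat_take_drop i q) !cat_path => /andP[-> /=].
have dq := drop_nth x lt_i; have := lasty.
rewrite -{1}(cat_take_drop i q) last_cat.
case: (drop i q) dq => // z t _ /= lt_y /andP[yz pt].
rewrite rev_cons.
have -> : rcons (rev t) z = last z t :: rev (belast z t).
  by rewrite -rev_cons lastI rev_rcons.
rewrite /= adjE_sym lt_y /= rev_path.
by rewrite (eq_path (e' := adjE E)) // => u v; rewrite adjE_sym.
Qed.

Lemma links_rev (y z : V) t a b : (a, b) \in pairmap pair z t ->
  (b, a) \in pairmap pair y (rev (z :: t)).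
Proof.
elim: t y z => // w t IH y z; rewrite /= inE => /orP[/eqP[-> ->]|/IH{}IH].
  rewrite rev_cons -cats1 pairmap_cat mem_cat rev_cons last_rcons /=.
  by rewrite inE eqxx orbT.
by rewrite rev_cons -cats1 pairmap_cat mem_cat IH.
Qed.

Lemma linksP q a b : uniq (x :: q) ->
  ((a, b) \in links q) = (b \in q) && (index b (x :: q) == (index a (x :: q)).+1).
Proof.
move=> uq; apply/idP/andP => [/(nthP (x, x))[i]|[bq /eqP ib]].
  rewrite size_pairmap => lt_i; rewrite (nth_pairmap x) // => -[<- <-].
  have := index_uniq x (lt_i : i.+1 < size (x :: q)) uq; rewrite [nth _ _ _]/= => ->.
  rewrite index_uniq //=; last by rewrite ltnS ltnW.
  by rewrite mem_nth.
have : b \in x :: q by rewrite inE bq orbT.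
rewrite -index_mem ib ltnS => lt_i.
have lt_a : index a (x :: q) < size (x :: q) by apply: ltn_trans lt_i _.
apply/(nthP (x, x)); exists (index a (x :: q)); first by rewrite size_pairmap.
rewrite (nth_pairmap x) // nth_index -?index_mem //; congr pair.
have -> : nth x q (index a (x :: q)) = nth x (x :: q) (index b (x :: q)) by rewrite ib.
by rewrite nth_index // inE bq orbT.
Qed.

Let R : {set V} := [set v | `[< exists2 q, rot_reach q & last x q = v >]].

Lemma mem_R q : rot_reach q -> last x q \in R.
Proof. by move=> rq; rewrite inE; apply/asboolP; exists q. Qed.

(* The first time a link of the initial path is broken, one of its ends becomes
   an end of the path. *)
Lemma rot_links q a b : rot_reach q -> (a, b) \in links p ->
  [\/ a \in R, b \in R, (a, b) \in links q | (b, a) \in links q].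
Proof.
move=> rq abp; elim: rq => [|{}q i rq IH lt_i lasty]; first by constructor 3.
have step : forall c d, (c, d) \in links q ->
  [\/ d \in R, (c, d) \in links (take i q ++ rev (drop i q))
   | (d, c) \in links (take i q ++ rev (drop i q))].
  move=> c d; rewrite /links -{1}(cat_take_drop i q) !pairmap_cat !mem_cat.
  case/orP => [->|]; first by constructor 2.
  have zR := mem_R (RotStep rq lt_i lasty).
  have dq := drop_nth x lt_i; move: zR; rewrite dq.
  set t := drop i.+1 q; set z := nth x q i => zR /=.
  rewrite inE => /orP[/eqP[_ ->]|cd].
    by constructor 1; move: zR; rewrite last_cat rev_cons last_rcons.
  by constructor 3; rewrite (links_rev _ cd) orbT.
by case: IH => [aR|bR|/step[]|/step[]];
  [constructor 1|constructor 2|constructor 2|constructor 3|constructor 4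
  |constructor 1|constructor 4|constructor 3].
Qed.

(** Let [w] be adjacent to the end of a rotated path [q]. By maximality [w] lies on [q], and
    rotating at [w] makes its successor in [q] an end. If no neighbour of [w] on [p] were in [R],
    all links of [p] at [w] would survive in [q], and one of them would lead to that successor,
    which is in [R]. *)
Lemma nbr_R w : w \in nbr E R :\: R ->
  exists2 r, r \in R & ((w, r) \in links p) || ((r, w) \in links p).
Proof.
rewrite !inE => /andP[wnR /exists_inP[u]].
rewrite inE => /asboolP[q rq <-{u}] uw.
have [pq perm_q uq] := rot_reach_inv rq.
have wR' : w \notin R by rewrite inE.
have wq : w \in x :: q.
  apply: contraT => wq.
  have : has_path E (size p).+2.
    apply/has_pathP; exists (rcons (x :: q) w); split.
    - by rewrite size_rcons /= (perm_size perm_q).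
    - by rewrite rcons_uniq wq.
    - by rewrite /= rcons_path pq.
  by move/p_longest; rewrite ltnn.
have mem_q v : (v \in x :: q) = (v \in x :: p) by rewrite !inE (perm_mem perm_q).
have wlast : w != last x q.
  by apply: contraNneq wR' => ->; apply: mem_R.
pose i := index w (x :: q).
have lt_i : i < size q.
  have : i < size (x :: q) by rewrite index_mem.
  rewrite /= ltnS leq_eqVlt => /orP[/eqP ei|//].
  by case/eqP: wlast; rewrite (last_nth x) -ei nth_index.
have wi : w = last x (take i q).
  rewrite (last_nth x) size_takel ?(ltnW lt_i) //.
  by rewrite -[x :: take i q]/(take i.+1 (x :: q)) nth_take // nth_index.
have zR : nth x q i \in R.
  have := mem_R (RotStep rq lt_i _); rewrite -wi => /(_ uw).
  by rewrite (drop_nth x lt_i) rev_cons last_cat last_rcons.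
set z := nth x q i in zR.
have wz v : (w, v) \in links q -> v = z.
  rewrite linksP // => /andP[vq /eqP iv].
  have vxq : v \in x :: q by rewrite inE vq orbT.
  by rewrite -[v](nth_index x vxq) iv.
have wp : w \in x :: p by rewrite -mem_q.
pose j := index w (x :: p).
have lt_j : j < size p.
  have : j < size (x :: p) by rewrite index_mem.
  rewrite /= ltnS leq_eqVlt => /orP[/eqP ei|//].
  case/negP: wR'; have -> : w = last x p by rewrite (last_nth x) -ei nth_index.
  exact: mem_R RotRefl.
pose s := nth x p j.
have sp : s \in p by rewrite mem_nth.
have idx_s : index s (x :: p) = j.+1.
  have := index_uniq x (lt_j : j.+1 < size (x :: p)) p_uniq; done.
have ws : (w, s) \in links p by rewrite linksP // sp idx_s /= eqxx.
case: (rot_links rq ws) => [wR|sR|wsq|swq].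
- by rewrite wR in wR'.
- by exists s => //; rewrite ws.
- by exists z => //; rewrite -(wz _ wsq) ws.
(* Now [s] precedes [w] in [q], so [w] is not [x]. Unless its predecessor [r] in [p] is in [R], the
   link between them leaves [w] in [q], as otherwise [r = s]. *)
case: (posnP j) => [j0|j_gt0].
  have wx : w = x by rewrite -(nth_index x wp) -/j j0.
  move: swq; rewrite linksP // wx => /andP[xq].
  by move: uq; rewrite /= xq.
pose r := nth x (x :: p) j.-1.
have lt_r : j.-1 < size (x :: p).
  by apply: leq_ltn_trans (leq_pred _) _; rewrite ltnS ltnW.
have idx_r : index r (x :: p) = j.-1 by rewrite index_uniq.
have rw : (r, w) \in links p.
  rewrite linksP // idx_r prednK // eqxx andbT.
  move: wp; rewrite inE => /orP[/eqP wx|//].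
  by move: j_gt0; rewrite /j wx /= eqxx.
case: (rot_links rq rw) => [rR|wR|rwq|wrq].
- by exists r => //; rewrite rw orbT.
- by rewrite wR in wR'.
- move: rwq swq; rewrite !linksP // => /andP[wq' /eqP e1] /andP[_ /eqP e2].
  have rs : r = s.
    have e3 : index r (x :: q) = index s (x :: q).
      by apply: succn_inj; rewrite -e1 -e2.
    have rq' : r \in x :: q by rewrite mem_q mem_nth.
    have sq' : s \in x :: q by rewrite mem_q inE sp orbT.
    by rewrite -(nth_index x rq') e3 nth_index.
  by move: idx_s; rewrite -rs idx_r => h; clear -h; lia.
- by exists z => //; rewrite -(wz _ wrq) rw orbT.
Qed.

(** Each member of [R] accounts for its two neighbours on [p]. The inequality is strict because
    [last x p] is in [R] and has no successor. *)
Lemma card_nbr_R : #|nbr E R :\: R| < 2 * #|R|.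
Proof.
pose succ r := nth x (x :: p) (index r (x :: p)).+1.
pose pred r := nth x (x :: p) (index r (x :: p)).-1.
have lastR : last x p \in R by apply: mem_R RotRefl.
have sub : nbr E R :\: R \subset succ @: (R :\ last x p) :|: pred @: R.
  apply/subsetP => w /nbr_R[r rR /orP[]]; rewrite linksP // => /andP[rp /eqP e];
    rewrite inE; apply/orP; [right|left]; apply/imsetP; exists r => //.
  - rewrite /pred e /=; rewrite nth_index // -index_mem /=.
    have : index r (x :: p) < size (x :: p) by rewrite index_mem inE rp orbT.
    by rewrite e ltnS; apply: ltnW.
  - rewrite in_setD1 rR andbT; apply/eqP => rl.
    have : index w (x :: p) < size (x :: p) by rewrite index_mem inE rp orbT.
    by rewrite e rl index_last // ltnn.
  - by rewrite /succ -e nth_index // inE rp orbT.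
apply: leq_ltn_trans (subset_leq_card sub) _.
apply: leq_ltn_trans (leq_card_setU _ _) _.
have h1 := leq_imset_card succ (R :\ last x p).
have h2 := leq_imset_card pred R.
have h3 := cardsD1 (last x p) R; rewrite lastR in h3.
by lia.
Qed.

(** The set of ends has fewer than twice its size in outside neighbours, so it must be too large for
    the expansion condition to apply. *)
Lemma posa_ends : expander E -> exists R' : {set V}, #|V| < 4 * #|R'| /\
  forall r, r \in R' ->
    exists q, [/\ path (adjE E) x q, perm_eq q p & last x q = r].
Proof.
move=> /forallP/(_ R)/implyP xE; exists R; split; last first.
  move=> r; rewrite inE => /asboolP[q rq qr]; exists q.
  by have [] := rot_reach_inv rq.
have R0 : R != set0 by apply/set0Pn; exists (last x p); apply: mem_R RotRefl.
rewrite ltnNge; apply/negP => le4.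
have /implyP/(_ le4) := xE R0.
by rewrite leqNgt card_nbr_R.
Qed.

End Posa.
End EdgeSets.

(** * Expanders have many boosters *)

Section Boosters.
Variable V : finType.
Implicit Types (E F : {set {set V}}) (A B : {set V}).

Lemma degE_incident E v : E \subset vpairs V ->
  degE E v = #|[set e in E | v \in e]|.
Proof.
move=> sE; rewrite /degE.
have inj : {in [set u | adjE E v u] &, injective (fun u => [set v; u])}.
  move=> a b; rewrite !inE => va vb eab.
  have na := adjE_neq sE va; have : a \in [set v; b] by rewrite -eab set22.
  by rewrite !inE eq_sym (negPf na) => /eqP.
rewrite -(card_in_imset inj); apply: eq_card => e; rewrite !inE.
apply/imsetP/andP => [[u]|[eE ve]].
  by rewrite inE /adjE => vu ->; rewrite set21.
have := subsetP sE _ eE; rewrite inE => /cards2P[a [b [ab ee]]].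
move: ve; rewrite ee !inE => /orP[/eqP->|/eqP->].
  by exists b => //; rewrite inE /adjE -ee.
exists a; last by rewrite setUC.
by rewrite inE /adjE setUC -ee.
Qed.

Lemma handshake E : E \subset vpairs V -> \sum_v degE E v = 2 * #|E|.
Proof.
move=> sE; under eq_bigr => v _ do rewrite degE_incident // -sum1_card.
under eq_bigr => v _.
  rewrite (eq_bigl (fun e => (e \in E) && (v \in e))); last first.
    by move=> e; rewrite inE.
  over.
rewrite (exchange_big_dep (mem E)) /=; last by move=> v e _ /andP[].
rewrite (eq_bigr (fun=> 2)) => [|e eE]; first by rewrite sum_nat_const mulnC.
rewrite (eq_bigl (mem e)) ?sum1_card; last by move=> v; rewrite /= eE.
by have := subsetP sE _ eE; rewrite inE => /eqP.
Qed.

(** This is connectedness. A closed set [B] on at most half of the vertices contains a set [C] of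
    [minn #|B| (#|V| %/ 4)] vertices, whose expansion inside [B] forces [3 * #|C| <= #|B|]. From 8
    vertices on, [3 * (#|V| %/ 4)] always exceeds half of [#|V|], a contradiction. A larger set is
    replaced by its complement. *)
Lemma expander_leaves E A : 8 <= #|V| -> expander E -> A != set0 -> A != setT ->
  exists u v, [/\ u \in A, v \notin A & adjE E u v].
Proof.
move=> V8 /forallP xE.
have key B : B != set0 -> 2 * #|B| <= #|V| ->
    exists u v, [/\ u \in B, v \notin B & adjE E u v].
  move=> B0 B2.
  have [] := boolP [exists u in B, exists v, (v \notin B) && adjE E u v].
    by move=> /exists_inP[u uB /existsP[v /andP[vB uv]]]; exists u, v.
  rewrite negb_exists_in => /forall_inP closed; exfalso.
  have nbrB (C : {set V}) : C \subset B -> nbr E C \subset B.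
    move=> /subsetP CB; apply/subsetP => v; rewrite inE => /exists_inP[u uC uv].
    apply: contraT => vB; have := closed u (CB _ uC).
    by rewrite negb_exists => /forallP/(_ v); rewrite vB uv.
  have B_gt0 : 0 < #|B| by rewrite card_gt0.
  have [C [CB C0 C4 big]] : exists C : {set V},
      [/\ C \subset B, C != set0, 4 * #|C| <= #|V| & #|B| < 3 * #|C|].
    have cC := card_ksub (geq_minl #|B| (#|V| %/ 4)).
    by exists (ksub (minn #|B| (#|V| %/ 4)) B); split; rewrite ?ksub_sub //;
      rewrite -?card_gt0 cC; clear -B_gt0 V8 B2; lia.
  have /implyP/(_ C0)/implyP/(_ C4) := xE C.
  have : #|nbr E C :\: C| + #|C| <= #|B|.
    rewrite -(cardsID C B) (setIidPr CB) addnC leq_add2l.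
    by apply/subset_leq_card/setSD/nbrB.
  by clear -big; lia.
move=> A0 AT; have [le|gt] := leqP (2 * #|A|) #|V|; first exact: key.
have cA := cardsC A.
have [||u [v [uA vA uv]]] := key (~: A).
- by apply: contraNneq AT => h; rewrite -(setCK A) h setC0.
- by clear -gt cA; lia.
by exists v, u; move: uA vA; rewrite !inE negbK adjE_sym.
Qed.

(** If the cycle misses a vertex, some edge leaves it; opening the cycle at the attachment vertex
    and prepending the outer vertex gives a path with one more vertex. *)
Lemma cycle_extends E F c : 8 <= #|V| -> expander E -> E \subset F ->
  0 < size c -> uniq c -> cycle (adjE F) c -> ham F \/ has_path F (size c).+1.
Proof.
move=> V8 xE sEF c0 uc cc.
have cs : #|[set x in c]| = size c by rewrite cardsE; apply/card_uniqP.
have [cT|cT] := eqVneq [set x in c] setT.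
  left; rewrite /ham (leq_trans _ V8) //=; apply/existsP.
  have sc : size c == #|V| by rewrite -cs cT cardsT.
  by exists (Tuple sc); rewrite /ucycleb /= cc.
right; have c00 : [set x in c] != set0 by rewrite -card_gt0 cs.
have [u [v [uc' vc uv]]] := expander_leaves V8 xE c00 cT.
rewrite !inE in uc' vc.
have [i t rt] := rot_to uc'; apply/has_pathP; exists (v :: u :: t); split.
- by rewrite /= -[(size t).+1]/(size (u :: t)) -rt size_rot.
- by rewrite cons_uniq -rt mem_rot rot_uniq vc.
- rewrite [sorted _ _]/= adjE_sym (adjE_sub sEF uv) /=.
  by move: cc; rewrite -(rot_cycle i) rt /= rcons_path => /andP[].
Qed.

(** Joining the ends of a longest path closes a cycle, which [cycle_extends] turns into a Hamilton
    cycle or a longer path. The same argument inside [E] shows that the pair is not yet an edge. *)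
Lemma booster_of_ends E x q : 8 <= #|V| -> E \subset vpairs V ->
  expander E -> ~~ ham E -> longest E (size q).+1 ->
  path (adjE E) x q -> uniq (x :: q) -> [set x; last x q] \in boosters E.
Proof.
move=> V8 sE xE nham lon pq uq; set e := [set x; _].
have grow F : E \subset F -> e \in F -> ham F \/ has_path F (size q).+2.
  move=> sEF eF; apply: (cycle_extends (E := E) (c := x :: q)) => //.
  rewrite /= rcons_path (sub_path _ pq) /=; last exact: adjE_sub.
  by rewrite adjE_sym.
have q0 : q != [::].
  apply/eqP => q0; have [||u [v [+ vx uv]]] := @expander_leaves E [set x] V8 xE.
  - by apply/set0Pn; exists x; rewrite inE.
  - by apply/eqP => h; have := cards1 x; rewrite h cardsT; clear -V8; lia.
  rewrite inE => /eqP ux; subst u.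
  have : has_path E 2.
    apply/has_pathP; exists [:: x; v]; rewrite /= uv inE eq_sym.
    by rewrite inE in vx; rewrite vx.
  by move/lon; rewrite q0.
have nE : e \notin E.
  apply/negP => eE; case: (grow E (subxx _) eE); first exact/negP.
  by move/lon; rewrite ltnn.
rewrite inE pairs_neq nE /=; apply/andP; split.
  move: uq => /= /andP[xq _]; apply: contra xq => /eqP xl; rewrite {1}xl.
  case: q q0 {xl pq lon grow nE e} => // a q _ /=; apply: mem_last.
have [-> //|hp] := grow (e |: E) (subsetUr _ _) (setU11 _ _).
apply/orP; right; apply/existsP.
have lt := has_path_size hp; rewrite -ltnS in lt.
exists (Ordinal lt); rewrite /= hp; apply/negP => /lon.
by rewrite ltnn.
Qed.

(** Rotating with one end fixed gives more than [#|V| / 4] ends [r]; reversing each path and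
    rotating with [r] fixed gives more than [#|V| / 4] ends [s]. The pairs [{r, s}] are boosters,
    each counted at most twice, whence [32 = 2 * 16]. *)
Lemma card_boosters E : 8 <= #|V| -> E \subset vpairs V ->
  expander E -> ~~ ham E -> #|V| ^ 2 <= 32 * #|boosters E|.
Proof.
move=> V8 sE xE nham.
have [x0 _] : exists x0 : V, x0 \in V by apply/card_gt0P; apply: leq_trans V8.
have [k /has_pathP[c [sc up pp]] lon] := longest_ex E x0.
have /lon : has_path E 1 by apply/has_pathP; exists [:: x0].
rewrite -sc in lon *; case: c {sc} => // x p in up pp lon * => _.
have [R [R4 Rp]] := posa_ends pp up lon xE.
have inner r : r \in R -> #|V| <= 4 * degE (boosters E) r.
  move=> /Rp[q [pq qp lastq]].
  have uxq : uniq (x :: q).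
    by move: up; rewrite /= (perm_mem qp) (perm_uniq qp).
  have er : rev (x :: q) = r :: rev (belast x q).
    by rewrite lastI rev_rcons lastq.
  have pr : path (adjE E) r (rev (belast x q)).
    rewrite -lastq rev_path (eq_path (e' := adjE E)) // => u v.
    by rewrite adjE_sym.
  have ur : uniq (r :: rev (belast x q)) by rewrite -er rev_uniq.
  have sr : size (rev (belast x q)) = size p.
    by rewrite size_rev size_belast (perm_size qp).
  have lonr : longest E (size (rev (belast x q))).+1 by rewrite sr.
  have [R' [R'4 R'p]] := posa_ends pr ur lonr xE.
  apply: leq_trans (ltnW R'4) _; rewrite leq_mul2l /=.
  apply/subset_leq_card/subsetP => s /R'p[q' [pq' qp' <-]].
  rewrite inE; apply: booster_of_ends => //.
    by rewrite (perm_size qp').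
  by move: ur; rewrite /= (perm_mem qp') (perm_uniq qp').
have sB : boosters E \subset vpairs V by apply/subsetP => e; rewrite inE => /andP[].
have : \sum_(r in R) #|V| <= 4 * \sum_r degE (boosters E) r.
  rewrite big_distrr /= [X in _ <= X](bigID (mem R)) /=.
  by apply: leq_trans (leq_addr _ _); apply: leq_sum.
rewrite handshake // sum_nat_const -mulnn; clear -R4; nia.
Qed.

End Boosters.

(** * Adding boosters one at a time *)

Section Iteration.
Variable V : finType.
Implicit Types (E F : {set {set V}}) (A B : {set V}).

Lemma ham_sub E F : E \subset F -> ham E -> ham F.
Proof.
move=> s /andP[n3 /existsP[c /andP[cc uc]]]; rewrite /ham n3 /=.
by apply/existsP; exists c; rewrite /ucycleb uc (sub_cycle (adjE_sub s)).
Qed.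

Lemma has_path_leq E k m : m <= k -> has_path E k -> has_path E m.
Proof.
move=> mk /has_pathP[c [sc uc pc]]; apply/has_pathP; exists (take m c); split.
- by rewrite size_takel ?sc.
- exact: take_uniq.
- exact: take_sorted.
Qed.

(** If [F] is not Hamiltonian, every booster taken from [F] lengthens the longest path, so after [i]
    additions there is a path on [i] vertices; [i = #|V| + 1] is absurd. *)
Lemma ham_of_boosters E F : E \subset F ->
  (forall E', E \subset E' -> E' \subset F -> #|E'| <= #|E| + #|V| ->
     ~~ ham E' -> exists2 e, e \in F & e \in boosters E') ->
  ham F.
Proof.
move=> sEF boost; apply: contraT => nham.
suff grow i : i <= #|V|.+1 -> exists E', [/\ E \subset E', E' \subset F,
    #|E'| <= #|E| + i & has_path E' i].
  by have [E' [_ _ _ /has_path_size]] := grow _ (leqnn _); rewrite ltnn.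
elim: i => [_|i IH lt_i].
  by exists E; split=> //; [rewrite addn0 | apply/has_pathP; exists [::]].
have [E' [sE sF cE hi]] := IH (ltnW lt_i).
have nham' : ~~ ham E' by apply: contra nham; apply: ham_sub.
have cE' : #|E'| <= #|E| + #|V| by apply: leq_trans cE _; rewrite leq_add2l.
have [e eF] := boost E' sE sF cE' nham'.
rewrite inE => /and3P[_ eE' e_boost].
have seF : e |: E' \subset F by rewrite subUset sub1set eF.
exists (e |: E'); split=> //.
- exact: subset_trans sE (subsetUr _ _).
- by rewrite cardsU1 eE'; move: cE; clear; lia.
case/orP: e_boost => [/(ham_sub seF)|/existsP[k /andP[hk nhk]]].
  by rewrite (negPf nham).
apply: has_path_leq hk; rewrite ltnNge; apply: contra nhk => ki.
exact: has_path_leq hi.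
Qed.

End Iteration.

(** * Small hitting sets *)

(** Bernoulli's inequality, giving [(1 - 1 / a) ^ a <= 1 / 2]: every [a] greedy choices halve the
    family still to be hit. *)
Lemma expn_pred_half a : 0 < a -> 2 * a.-1 ^ a <= a ^ a.
Proof.
case: a => // b _; rewrite [_.-1]/=.
have bern m : b ^ m.+1 + m.+1 * b ^ m <= b.+1 ^ m.+1.
  elim: m => [|m IH]; first by rewrite !expn1 expn0; lia.
  rewrite [b.+1 ^ _]expnS; apply: leq_trans (leq_mul (leqnn _) IH).
  by rewrite !expnS; nia.
by apply: leq_trans (bern b); rewrite expnS; nia.
Qed.

Section Hitting.
Variables (I T : finType) (U : {set T}) (Fam : {set I}) (h : I -> {set T}).
Variable a : nat.
Hypothesis h_sub : forall i, i \in Fam -> h i \subset U.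
Hypothesis h_big : forall i, i \in Fam -> #|U| <= a * #|h i|.
Hypothesis U_gt0 : 0 < #|U|.

(* Greedy choice: by double counting, some element of [U] hits a proportion
   [1 / a] of the sets not hit so far. *)
Lemma hitting_step t : exists2 X : {set T}, X \subset U & #|X| <= t /\
  a ^ t * #|[set i in Fam | [disjoint h i & X]]| <= a.-1 ^ t * #|Fam|.
Proof.
elim: t => [|t [X sX [cX IH]]].
  exists set0; rewrite ?sub0set // cards0; split=> //.
  by rewrite !expn0 !mul1n; apply/subset_leq_card/subsetP => i; rewrite inE => /andP[].
set M := [set i in Fam | _] in IH.
pose hit e := [set i in M | e \in h i].
have sum_hit : \sum_(e in U) #|hit e| = \sum_(i in M) #|h i|.
  under eq_bigr => e _ do rewrite -sum1_card.
  under eq_bigr => e _.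
    rewrite (eq_bigl (fun i => (i \in M) && (e \in h i))); last first.
      by move=> i; rewrite inE.
    over.
  rewrite (exchange_big_dep (mem M)) /=; last by move=> e i _ /andP[].
  apply: eq_bigr => i iM; rewrite -sum1_card; apply: eq_bigl => e /=.
  rewrite iM /=; case: (boolP (e \in h i)); rewrite ?andbT ?andbF // => ei.
  by apply: (subsetP (h_sub _)) ei; move: iM; rewrite inE => /andP[].
have [e eU he] : exists2 e, e \in U & #|M| <= a * #|hit e|.
  apply/exists_inP; apply: contraT; rewrite negb_exists_in => /forall_inP no.
  have lt : \sum_(e in U) (a * #|hit e|) < \sum_(e in U) #|M|.
    have /card_gt0P[e0 e0U] := U_gt0.
    rewrite (bigD1 e0) //= [X in _ < X](bigD1 e0) //= -addSn.
    apply: leq_add; first by have := no _ e0U; rewrite -ltnNge.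
    by apply: leq_sum => e /andP[eU _]; have := no _ eU; rewrite -ltnNge => /ltnW.
  have ge : \sum_(e in U) #|M| <= \sum_(e in U) (a * #|hit e|).
    rewrite -big_distrr /= sum_hit big_distrr /= sum_nat_const mulnC -sum_nat_const.
    by apply: leq_sum => i; rewrite inE => /andP[/h_big].
  by move: (leq_ltn_trans ge lt); rewrite ltnn.
exists (e |: X); first by rewrite subUset sub1set eU.
split; first by rewrite cardsU1; case: (_ \notin _); move: cX; clear; lia.
set M' := [set i in Fam | _].
have M'M : M' \subset M :\: hit e.
  apply/subsetP => i; rewrite !inE => /andP[iF dis]; rewrite iF /=.
  by rewrite (disjointFl dis) ?setU11 // (disjointWr (subsetUr _ _) dis).
have cM : #|M'| + #|hit e| <= #|M|.
  have sub : hit e \subset M by apply/subsetP => i; rewrite inE => /andP[].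
  rewrite -(cardsID (hit e) M) (setIidPr sub) addnC leq_add2l.
  exact: subset_leq_card.
rewrite !expnS; apply: leq_trans (_ : a ^ t * (a.-1 * #|M|) <= _).
  rewrite -mulnA mulnCA leq_mul2l; apply/orP; right.
  case: a he => [|b] /=; first by lia.
  by move: cM; clear; nia.
by rewrite mulnCA -mulnA leq_mul2l IH orbT.
Qed.

(** After [a * m] greedy choices the number of missed sets is at most [#|Fam| / 2 ^ m], hence
    zero. *)
Lemma hitting_set m : #|Fam| < 2 ^ m -> 0 < a ->
  exists X : {set T}, [/\ X \subset U, #|X| <= a * m &
    forall i, i \in Fam -> exists2 e, e \in h i & e \in X].
Proof.
move=> cF a_gt0; have [X sX [cX miss]] := hitting_step (a * m).
exists X; split=> // i iF; apply/exists_inP; apply: contraT.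
rewrite negb_exists_in => /forall_inP no.
have iM : i \in [set i in Fam | [disjoint h i & X]].
  rewrite inE iF disjoint_subset; apply/subsetP => e; exact: no.
have M1 : 0 < #|[set i in Fam | [disjoint h i & X]]| by apply/card_gt0P; exists i.
have h2 : 2 ^ m * a.-1 ^ (a * m) <= a ^ (a * m).
  rewrite !expnM -expnMn; case: (posnP m) => [->//|m_gt0].
  by rewrite leq_exp2r //; apply: expn_pred_half.
have ap : 0 < a ^ (a * m) by rewrite expn_gt0 a_gt0.
have le1 : a ^ (a * m) <= a.-1 ^ (a * m) * #|Fam|.
  by apply: leq_trans miss; rewrite leq_pmulr.
have P0 : 0 < a.-1 ^ (a * m).
  by case: posnP le1 => // ->; rewrite leqNgt ap.
have : a.-1 ^ (a * m) * #|Fam| < a.-1 ^ (a * m) * 2 ^ m by rewrite ltn_pmul2l.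
by rewrite ltnNge (leq_trans _ le1) // mulnC.
Qed.

End Hitting.

(** * Sparse expanders inside a graph with deleted edges *)

Lemma sum_card_bigcup (S T : finType) (A : {set S}) (C : S -> {set T}) :
  (forall s s' t, s \in A -> s' \in A -> t \in C s -> t \in C s' -> s = s') ->
  \sum_(s in A) #|C s| <= #|\bigcup_(s in A) C s|.
Proof.
move=> inj; under eq_bigr => s _ do rewrite -sum1_card.
rewrite (exchange_big_dep (mem (\bigcup_(s in A) C s))) /=; last first.
  by move=> s t sA ts; apply/bigcupP; exists s.
rewrite -sum1_card; apply: leq_sum => t _; rewrite sum1_card.
apply/card_le1P => s; rewrite !unfold_in => /andP[sA ts] s'.
rewrite !unfold_in; apply/andP/eqP => [[s'A ts']|->//].
exact: inj ts' ts.
Qed.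

Lemma card_bigcup_leq (S T : finType) (P : pred S) (C : S -> {set T}) :
  #|\bigcup_(s | P s) C s| <= \sum_(s | P s) #|C s|.
Proof.
elim/big_rec2: _ => [|s m X _ le]; first by rewrite cards0.
by apply: leq_trans (leq_card_setU _ _) _; rewrite leq_add2l.
Qed.

Section SparseExpander.
Variable V : finType.
Implicit Types (E F G H X : {set {set V}}) (A B W : {set V}) (d w : nat).

(** For low-degree vertices, excluding an edge keeps their chosen neighbours of ordinary degree;
    excluding paths of two edges keeps their neighbourhoods disjoint; excluding paths of four edges
    prevents an ordinary vertex from reaching chosen neighbours of two different low-degree
    vertices. *)
Definition far_apart G u v :=
  [/\ ~~ adjE G u v,
      forall w : V, adjE G u w -> adjE G w v -> False &
      forall a w b : V, uniq [:: u; a; w; b; v] ->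
        adjE G u a -> adjE G a w -> adjE G w b -> adjE G b v -> False].

Definition far_low_degree G d := forall u v, u != v ->
  degE G u <= 2 * d -> degE G v <= 2 * d -> far_apart G u v.

(** The constant 12 fits a set [A2] of vertices with [d] chosen edges each: were all these edges
    inside some [W] with fewer than [6 * #|A2|] vertices, there would be at least [d * #|A2| / 2] of
    them. The same 6 separates small sets from large ones in [well_connected]. *)
Definition locally_sparse G d w := forall W, W != set0 -> #|W| <= w ->
  12 * #|[set e in G | e \subset W]| < d * #|W|.

Definition well_connected X w := forall A B, [disjoint A & B] ->
  w < 6 * #|A| -> #|V| <= 4 * #|B| ->
  exists u v, [/\ u \in A, v \in B & adjE X u v].

Lemma degE_setD G H v : G \subset vpairs V -> H \subset G ->
  degE G v = degE (G :\: H) v + degE H v.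
Proof.
move=> sG sH; rewrite /degE -(cardsID [set u | adjE H v u] [set u | adjE G v u]).
rewrite addnC; congr (_ + _); apply: eq_card => u; rewrite !inE /adjE ?inE //.
by apply: andb_idl => /(subsetP sH).
Qed.

(** Only the pair [{u, v}] itself can be counted at both vertices. *)
Lemma degE_pair_leq H u v : H \subset vpairs V -> u != v ->
  degE H u + degE H v <= #|H| + 1.
Proof.
move=> sH uv; rewrite !degE_incident //.
set Eu := [set e in H | u \in e]; set Ev := [set e in H | v \in e].
rewrite -cardsUI; apply: leq_add.
  by apply/subset_leq_card; rewrite subUset /Eu /Ev !setIdE !subsetIl.
rewrite -(cards1 [set u; v]); apply/subset_leq_card/subsetP => e.
rewrite !inE => /andP[/andP[eH ue] /andP[_ ve]].
rewrite eq_sym eqEcard subUset !sub1set ue ve /=.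
by have := subsetP sH _ eH; rewrite inE cards2 uv => /eqP ->.
Qed.

(* If distinct [u] and [v] both have degree at most [d] in [G :\: H], then,
   since their degrees in [H] add up to at most [#|H| + 1], both have degree
   less than [2 * d] in [G]: however [H] is chosen, the vertices of low degree
   in [G :\: H] are far apart in [G]. Each of them contributes two edges to
   the expander and every other vertex [d] edges avoiding them; [X] takes care
   of the large sets. *)
Lemma sparse_expander G H X d w :
  G \subset vpairs V -> H \subset G ->
  (forall v, #|H| + 2 <= degE G v) ->
  far_low_degree G d -> locally_sparse G d w ->
  X \subset G :\: H -> well_connected X w ->
  exists2 E : {set {set V}}, E \subset G :\: H & #|E| <= #|V| * (d + 2) + #|X| /\ expander E.
Proof.
move=> sG sH degG far sparse sX conn.
pose F := G :\: H; have sFG : F \subset G by apply: subsetDl.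
have sF : F \subset vpairs V := subset_trans sFG sG.
have sHV : H \subset vpairs V := subset_trans sH sG.
pose N v := [set u | adjE F v u].
pose S := [set v | degE F v <= d].
have farS u v : u \in S -> v \in S -> u != v -> far_apart G u v.
  rewrite !inE => uS vS uv.
  have h1 := degE_setD u sG sH; have h2 := degE_setD v sG sH.
  have h3 := degE_pair_leq sHV uv; have h4 := degG u; have h5 := degG v.
  by apply: far => //; move: uS vS h1 h2 h3 h4 h5; rewrite -/F; clear; lia.
have NG v u : u \in N v -> adjE G v u by rewrite inE => /(adjE_sub sFG).
pose C v := if v \in S then ksub 2 (N v) else ksub d (N v :\: S).
have CN v : C v \subset N v.
  rewrite /C; case: ifP => _; first exact: ksub_sub.
  by apply: subset_trans (ksub_sub _ _) (subsetDl _ _).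
have CG v u : u \in C v -> adjE G v u by move/(subsetP (CN v))/NG.
have cardCS v : v \in S -> #|C v| = 2.
  move=> vS; rewrite /C vS card_ksub //.
  have h1 := degE_setD v sG sH; have h4 := degG v.
  have : degE H v <= #|H|.
    by rewrite degE_incident //; apply/subset_leq_card; rewrite setIdE subsetIl.
  by move: h1 h4; rewrite -/F /degE -/(N v); clear; lia.
have cardC v : v \notin S -> #|C v| = d.
  move=> vS; rewrite /C (negPf vS) card_ksub //.
  (* Two neighbours of [v] in [S] would be joined by a path of two edges; so of the more than [d]
     neighbours of [v], at least [d] are outside [S]. *)
  have le1 : #|N v :&: S| <= 1.
    apply/card_le1P => s; rewrite inE => /andP[sN sS] s'; rewrite !inE.
    apply/andP/eqP => [[s'N s'S]|->]; last by move: sN sS; rewrite !inE.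
    apply/eqP; apply: contraT => ss'.
    have s'N' : s' \in N v by rewrite inE.
    have s'S' : s' \in S by rewrite inE.
    have [_ /(_ v) no _] := farS _ _ s'S' sS ss'.
    by case: no; [rewrite adjE_sym; apply: NG | apply: NG].
  move: vS (cardsID S (N v)); rewrite inE -ltnNge {1}/degE -/(N v).
  by move: le1; clear; lia.
have CnS v u : v \notin S -> u \in C v -> u \notin S.
  by move=> vS; rewrite /C (negPf vS) => /(subsetP (ksub_sub _ _)); rewrite inE => /andP[].
pose E1 := \bigcup_v [set [set v; u] | u in C v].
have sE1 : E1 \subset F.
  apply/subsetP => e /bigcupP[v _ /imsetP[u uC ->]].
  by have := subsetP (CN v) _ uC; rewrite inE.
exists (E1 :|: X); first by rewrite subUset sE1 sX.
split.
  apply: leq_trans (leq_card_setU _ _) _; rewrite leq_add2r.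
  apply: leq_trans (card_bigcup_leq _ _) _.
  rewrite -sum_nat_const; apply: leq_sum => v _.
  apply: leq_trans (leq_imset_card _ _) _.
  by case: (boolP (v \in S)) => vS; rewrite ?(cardCS _ vS) ?(cardC _ vS); clear; lia.
have nbrE A v u : v \in A -> u \in C v -> u \in nbr (E1 :|: X) A.
  move=> vA uC; rewrite inE; apply/exists_inP; exists v => //.
  rewrite /adjE inE; apply/orP; left; apply/bigcupP; exists v => //.
  by apply/imsetP; exists u.
apply/forallP => A; apply/implyP => A0; apply/implyP => A4.
(* If a large [A] fails to expand, [A] and its neighbours cover at most three quarters of the
   vertices, and [X] has an edge from [A] to the rest. *)
have [A6|A6] := leqP (6 * #|A|) w; last first.
  rewrite leqNgt; apply/negP => small.
  have [||u [v [uA vB uv]]] := conn A (~: (A :|: nbr (E1 :|: X) A)) _ A6.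
  - by rewrite -setI_eq0 setCU setIA setICr set0I.
  - have := cardsC (A :|: nbr (E1 :|: X) A).
    have : #|A :|: nbr (E1 :|: X) A| = #|A| + #|nbr (E1 :|: X) A :\: A|.
      by rewrite -(cardsID A (A :|: _)) setUK setDUl setDv set0U.
    by move: small A4; clear; lia.
  move: vB; rewrite !inE negb_or => /andP[_ /exists_inP[]]; exists u => //.
  by apply: adjE_sub uv; apply: subsetUr.
(* Count for small [A]: [T] has at least [2 * #|A1|] vertices, at most [#|A2|] of them in [A2];
   [N2 :\: A2] has at least [5 * #|A2|], at most [2 * #|A2|] of them in [T]. Both avoid [S], hence
   [A1], and [2 * #|A1| + (5 - 1 - 2) * #|A2| = 2 * #|A|]. *)
pose A1 := A :&: S; pose A2 := A :\: S.
pose T := \bigcup_(s in A1) C s; pose N2 := \bigcup_(v in A2) C v.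
have A1S s : s \in A1 -> s \in S by rewrite inE => /andP[].
have A2S s : s \in A2 -> s \notin S by rewrite inE => /andP[].
have cardT : 2 * #|A1| <= #|T|.
  rewrite mulnC -sum_nat_const -(eq_bigr _ (fun s sA1 => cardCS s (A1S s sA1))).
  apply: sum_card_bigcup => s s' t /A1S sS /A1S s'S ts ts'.
  apply/eqP; apply: contraT => ss'.
  have [_ /(_ t) no _] := farS _ _ sS s'S ss'.
  by case: no; [apply: CG | rewrite adjE_sym; apply: CG].
have N2S u : u \in N2 -> u \notin S by case/bigcupP => v /A2S vS; apply: CnS.
have TS t : t \in T -> t \notin S.
  case/bigcupP => s /A1S sS tC; apply/negP => tS.
  have st := CG _ _ tC; have [no _ _] := farS _ _ sS tS (adjE_neq sG st).
  by rewrite st in no.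
have bigN2 : 5 * #|A2| <= #|N2 :\: A2|.
  rewrite leqNgt; apply/negP => small.
  pose W := A2 :|: N2.
  have cW : #|W| = #|A2| + #|N2 :\: A2|.
    by rewrite -(cardsID A2 W) setUK setDUl setDv set0U.
  have cA2 : #|A2| <= #|A| by apply/subset_leq_card/subsetDl.
  have W0 : W != set0.
    apply: contraTneq small => W0; rewrite -leqNgt.
    by move: cW; rewrite W0 cards0; clear; lia.
  have := sparse W W0; set EW := [set e in G | _].
  have sEW : EW \subset vpairs V.
    by apply: subset_trans sG; rewrite /EW setIdE subsetIl.
  have : d * #|A2| <= 2 * #|EW|.
    rewrite -handshake // mulnC -sum_nat_const [X in _ <= X](bigID (mem A2)) /=.
    apply: leq_trans (leq_addr _ _); apply: leq_sum => v vA2.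
    rewrite -(cardC v (A2S v vA2)); apply/subset_leq_card/subsetP => u uC.
    rewrite inE /adjE inE [_ \in G](CG _ _ uC) /= subUset !sub1set /W !in_setU vA2 /=.
    apply/orP; right.
    by apply/bigcupP; exists v.
  by move: small cW cA2 A6; clear; nia.
(* For each [v] in [A2], the part of [C v] in [T] lies in a single [C s]: a second [s'] would give
   [s, t, v, t', s'], a forbidden path of four edges, or of two edges if [t = t']. *)
have smallNT : #|N2 :&: T| <= 2 * #|A2|.
  have -> : N2 :&: T = \bigcup_(v in A2) (C v :&: T) by rewrite -big_distrl.
  apply: leq_trans (card_bigcup_leq _ _) _.
  rewrite mulnC -sum_nat_const; apply: leq_sum => v vA2.
  have [->|[t]] := set_0Vmem (C v :&: T); first by rewrite cards0.
  rewrite inE => /andP[tv /bigcupP[s sA1 ts]].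
  rewrite -(cardCS s (A1S s sA1)); apply/subset_leq_card/subsetP => t'.
  rewrite inE => /andP[t'v /bigcupP[s' s'A1 t's']].
  have [-> //|ss'] := eqVneq s s'.
  have sS := A1S _ sA1; have s'S := A1S _ s'A1; have vS := A2S _ vA2.
  have [no1 no2 no4] := farS _ _ sS s'S ss'.
  have st := CG _ _ ts; have vt := CG _ _ tv.
  have vt' := CG _ _ t'v; have s't' := CG _ _ t's'.
  have neqS a b : a \in S -> b \notin S -> a != b.
    by move=> aS; apply: contraNneq => <-.
  have tS : t \notin S := CnS _ _ vS tv.
  have t'S : t' \notin S := CnS _ _ vS t'v.
  case: (no4 t v t') => //; rewrite 1?adjE_sym //.
  rewrite /= !inE !negb_or ss' (neqS s) // (neqS s v) // (neqS s t') //.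
  rewrite [t == v]eq_sym (adjE_neq sG vt) (adjE_neq sG vt').
  rewrite ![_ == s']eq_sym !(neqS s') //= !andbT.
  by apply/eqP => tt'; apply: (no2 t) => //; rewrite tt' adjE_sym.
have sub : (T :\: A2) :|: (N2 :\: A2 :\: T) \subset nbr (E1 :|: X) A :\: A.
  have nA u : u \notin S -> u \notin A2 -> u \notin A.
    by move=> uS; rewrite [_ \in A2]inE uS.
  apply/subsetP => u; rewrite in_setU => /orP[|].
    rewrite in_setD => /andP[uA2 uT]; rewrite in_setD (nA _ (TS _ uT) uA2) /=.
    by case/bigcupP: uT => s; rewrite inE => /andP[sA _]; apply: nbrE.
  rewrite in_setD => /andP[_]; rewrite in_setD => /andP[uA2 uN].
  rewrite in_setD (nA _ (N2S _ uN) uA2) /=.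
  by case/bigcupP: uN => s; rewrite inE => /andP[_ sA]; apply: nbrE.
apply: leq_trans (subset_leq_card sub).
have dis : #|(T :\: A2) :|: (N2 :\: A2 :\: T)| = #|T :\: A2| + #|N2 :\: A2 :\: T|.
  apply/eqP; rewrite (eq_leqif (leq_card_setU _ _)) -setI_eq0.
  by apply/eqP/setP => u; rewrite !inE; case: (u \in T); rewrite ?andbF.
have c1 := cardsID A2 T; have c2 := cardsID T (N2 :\: A2).
have c3 : #|T :&: A2| <= #|A2| by apply/subset_leq_card/subsetIr.
have c4 : #|(N2 :\: A2) :&: T| <= #|N2 :&: T|.
  by apply/subset_leq_card/setSI/subsetDl.
have c5 := cardsID S A.
by move: c1 c2 c3 c4 c5 dis smallNT bigN2 cardT; rewrite -/A1 -/A2; clear; lia.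
Qed.

End SparseExpander.

(** * Resilience under deterministic conditions on the graph *)

Section Resilience.
Variable V : finType.
Implicit Types (E F G H X : {set {set V}}) (A B W : {set V}) (d w : nat).

Definition cross_pairs A B : {set {set V}} := [set [set u; v] | u in A, v in B].

Definition large_cuts G w K := forall A B, [disjoint A & B] ->
  w < 6 * #|A| -> #|V| <= 4 * #|B| -> K <= #|G :&: cross_pairs A B|.

Definition many_boosters G m := forall E, E \subset G -> #|E| <= m ->
  expander E -> ~~ ham E -> #|V| <= #|G :&: boosters E|.

(** As [H] has fewer than [#|V|] edges, each large cut keeps at least [K - #|V|] edges in [G :\: H],
    a proportion of at least [1 / a]. The bound in [many_boosters] adds up the chosen edges, the
    hitting set and the boosters added later. *)
Lemma resilient_ham G H d w K a :
  8 <= #|V| -> G \subset vpairs V -> H \subset G ->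
  (forall v, #|H| + 2 <= degE G v) ->
  far_low_degree G d -> locally_sparse G d w -> large_cuts G w K ->
  #|G| <= a * (K - #|V|) ->
  many_boosters G (#|V| * (d + 2) + a * (2 * #|V|).+1 + #|V|) ->
  ham (G :\: H).
Proof.
move=> V8 sG sH degG far sparse cuts cG boost.
have [v0 _] : exists v0 : V, v0 \in V by apply/card_gt0P; apply: leq_trans V8.
have cH : #|H| < #|V|.
  by have := degG v0; have := max_card [set u | adjE G v0 u]; rewrite /degE; clear; lia.
have F0 : 0 < #|G :\: H|.
  have := degE_setD v0 sG sH; have := degG v0.
  have sHV := subset_trans sH sG.
  have : degE H v0 <= #|H|.
    by rewrite degE_incident //; apply/subset_leq_card; rewrite setIdE subsetIl.
  have : degE (G :\: H) v0 <= #|G :\: H|.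
    rewrite degE_incident; last exact: subset_trans (subsetDl _ _) sG.
    by apply/subset_leq_card; rewrite setIdE subsetIl.
  by clear; lia.
pose Fam := [set AB : {set V} * {set V} |
  [&& [disjoint AB.1 & AB.2], w < 6 * #|AB.1| & #|V| <= 4 * #|AB.2|]].
pose h (AB : {set V} * {set V}) := (G :\: H) :&: cross_pairs AB.1 AB.2.
have hsub i : i \in Fam -> h i \subset G :\: H by move=> _; apply: subsetIl.
have hbig i : i \in Fam -> #|G :\: H| <= a * #|h i|.
  rewrite inE => /and3P[dis wA wB]; have := cuts _ _ dis wA wB.
  have : #|G :&: cross_pairs i.1 i.2| <= #|h i| + #|H|.
    rewrite /h setIDAC -(cardsID H (G :&: _)) addnC leq_add2l.
    by apply/subset_leq_card/subsetIr.
  have cF : #|G :\: H| <= #|G| by apply/subset_leq_card/subsetDl.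
  move=> h1 h2; apply: leq_trans cF (leq_trans cG _); rewrite leq_mul2l.
  apply/orP; right; rewrite leq_subLR; apply: leq_trans h2 (leq_trans h1 _).
  by rewrite addnC leq_add2r ltnW.
(* There are at most [4 ^ #|V|] pairs of sets; the successor makes the inequality strict, as
   [hitting_set] demands. *)
have cFam : #|Fam| < 2 ^ (2 * #|V|).+1.
  apply: leq_ltn_trans (max_card _) _.
  rewrite card_prod -cardsT -powersetT card_powerset cardsT -expnD addnn -mul2n.
  by rewrite ltn_exp2l.
have a0 : 0 < a.
  have := leq_trans F0 (subset_leq_card (subsetDl G H)).
  by move/leq_trans/(_ cG); case: (a).
have [X [sX cX hit]] := hitting_set hsub hbig F0 cFam a0.
have conn : well_connected X w.
  move=> A B dis wA wB.
  have [|e] := hit (A, B); first by rewrite inE dis wA wB.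
  rewrite inE => /andP[_ /imset2P[u v uA vB ->]] uvX.
  by exists u, v.
have [E sE [cE xE]] := sparse_expander sG sH degG far sparse sX conn.
apply: (ham_of_boosters sE) => E' sEE' sE'F cE' nham.
have sE'G : E' \subset G := subset_trans sE'F (subsetDl _ _).
have cE'm : #|E'| <= #|V| * (d + 2) + a * (2 * #|V|).+1 + #|V|.
  by move: cE' cE cX; clear; lia.
have many := boost E' sE'G cE'm (expander_sub sEE' xE) nham.
have : ~~ (G :&: boosters E' \subset H).
  by apply/negP => /subset_leq_card; move: cH many; clear; lia.
case/subsetPn => e; rewrite inE => /andP[eG eB] eH; exists e => //.
by rewrite inE eH.
Qed.

Lemma ham_degE E v : E \subset vpairs V -> ham E -> 2 <= degE E v.
Proof.
move=> sE /andP[V3 /existsP[c /andP[cc uc]]].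
have vc : v \in (c : seq V).
  have cT : [set x in (c : seq V)] = setT.
    apply/eqP; rewrite eqEcard subsetT cardsT cardsE (card_uniqP uc).
    by rewrite (size_tuple c) leqnn.
  by have := in_setT v; rewrite -cT inE.
have [i t rt] := rot_to vc.
have := rot_uniq i c; rewrite uc rt => /andP[vt ut].
have := cc; rewrite -(rot_cycle i) rt /=.
have st : size (v :: t) = #|V| by rewrite -rt size_rot (size_tuple c).
case: t st vt ut {rt} => [|u [|u' t]]; try by move=> e; move: V3; rewrite -e.
move=> _ vt /andP[ut _] /=; rewrite rcons_path /= => /and3P[vu _ /andP[_ lv]].
rewrite /degE (cardD1 u) (cardD1 (last u' t)) !inE vu adjE_sym lv andbT /=.
by rewrite (memPn ut) // mem_last.
Qed.

Lemma bigmin_leq (f : V -> nat) m v : \big[minn/m]_x f x <= f v.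
Proof.
elim: (index_enum V) (mem_index_enum v) => // x s IH.
rewrite inE big_cons => /orP[/eqP <-|/IH le]; first exact: geq_minl.
exact: leq_trans (geq_minr _ _) le.
Qed.

Lemma min_degree_leq (G : sgraph V) v : min_degree G <= degE (edges G) v.
Proof. exact: bigmin_leq. Qed.

Lemma min_degree_attained (G : sgraph V) : 0 < #|V| ->
  exists v, degE (edges G) v = min_degree G.
Proof.
move=> /card_gt0P[v0 _].
have : min_degree G = #|V| \/ exists v, degE (edges G) v = min_degree G.
  rewrite /min_degree.
  elim/big_rec: _ => [|v m _ IH]; first by left.
  rewrite /minn; case: ifP => _; last exact: IH.
  by right; exists v.
(* The default value [#|V|] bounds every degree from above, so if it were the minimum, [v0] would
   attain it. *)
case=> // eV; exists v0; apply/eqP; rewrite eqn_leq min_degree_leq andbT eV.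
exact: max_card.
Qed.

(** The upper bound removes all but one of the edges at a vertex of minimum degree; the hypothesis
    on [H] rules out anything cheaper. *)
Lemma global_resilience_hamiltonian (G : sgraph V) : 3 <= #|V| ->
  2 <= min_degree G ->
  (forall H : sgraph V, edges H \subset edges G ->
     num_edges H + 2 <= min_degree G -> hamiltonian (gdiff G H)) ->
  global_resilience (@hamiltonian V) G = (min_degree G).-1.
Proof.
move=> V3 d2 res.
have sG := edges_subproof G.
have [v dv] : exists v, degE (edges G) v = min_degree G.
  by apply: min_degree_attained; apply: leq_trans V3.
have break H : H \subset edges G -> degE (edges G :\: H) v < 2 ->
    breaks_by_removing (@hamiltonian V) G #|H|.
  move=> sH lt2; apply/existsP; exists (SGraph (subset_trans sH sG)).
  rewrite sH eqxx /=; apply: contraL lt2 => hG; rewrite -leqNgt.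
  by apply: (ham_degE _ (subset_trans (subsetDl _ _) sG)) hG.
pose Ev := [set e in edges G | v \in e].
have sEv : Ev \subset edges G by rewrite /Ev setIdE subsetIl.
have cEv : #|Ev| = min_degree G by rewrite -dv degE_incident.
pose H := ksub (min_degree G).-1 Ev.
have sHE : H \subset Ev := ksub_sub _ _.
have sH := subset_trans sHE sEv.
have cH : #|H| = (min_degree G).-1 by rewrite card_ksub // cEv leq_pred.
have dH : degE H v = #|H|.
  rewrite (degE_incident _ (subset_trans sH sG)); apply: eq_card => e; rewrite inE.
  apply: andb_idr => /(subsetP sHE).
  by rewrite inE => /andP[].
have breakH : breaks_by_removing (@hamiltonian V) G (min_degree G).-1.
  rewrite -cH; apply: break => //.
  by have := degE_setD v sG sH; rewrite dv dH cH; move: d2; clear; lia.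
have lt_m : (min_degree G).-1 < (num_edges G).+1.
  by rewrite ltnS -cH; apply: subset_leq_card.
(* The default of the minimum must itself qualify: removing all edges destroys every Hamilton
   cycle. *)
rewrite /global_resilience; case: arg_minnP => [|i Pi min_i].
  apply: break => //; rewrite setDv /degE (_ : [set _ | _] = set0) ?cards0 //.
  by apply/setP => u; rewrite /adjE !inE.
apply/eqP; rewrite eqn_leq (min_i (Ordinal lt_m)) //=.
rewrite leqNgt; apply/negP => lt_i.
have /existsP[H' /and3P[sH' /eqP cH' /negP[]]] := Pi.
by apply: res => //; rewrite cH'; move: lt_i d2; clear; lia.
Qed.

End Resilience.

(** * Stars, paths and cuts as sets of pairs *)

Section Pairs.
Variable V : finType.
Implicit Types (E : {set {set V}}) (A B S W : {set V}) (u v : V) (s : seq V).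

Definition star v S : {set {set V}} := [set [set v; x] | x in S].

Lemma star_vpairs v S : v \notin S -> star v S \subset vpairs V.
Proof.
move=> vS; apply/subsetP => e /imsetP[x xS ->]; rewrite pairs_neq.
by apply: contraNneq vS => ->.
Qed.

Lemma set2_injr v x x' : v != x -> [set v; x] = [set v; x'] -> x = x'.
Proof.
move=> vx e; have : x \in [set v; x'] by rewrite -e set22.
by rewrite !inE eq_sym (negPf vx) => /eqP.
Qed.

Lemma card_star v S : v \notin S -> #|star v S| = #|S|.
Proof.
move=> vS; apply: card_in_imset => x x' xS _; apply: set2_injr.
by apply: contraNneq vS => ->.
Qed.

Lemma card_setI_star E v S : #|E :&: star v S| <= degE E v.
Proof.
apply: leq_trans (leq_imset_card (fun x => [set v; x]) _).
apply/subset_leq_card/subsetP => e; rewrite inE => /andP[eE /imsetP[x xS ex]].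
by apply/imsetP; exists x => //; rewrite inE /adjE -ex.
Qed.

Fixpoint path_edges u s : {set {set V}} :=
  if s is v :: s' then [set u; v] |: path_edges v s' else set0.

Lemma path_edges_sub E u s : path (adjE E) u s -> path_edges u s \subset E.
Proof.
elim: s u => [|v s IH] u /=; first by rewrite sub0set.
by case/andP => uv /IH sE; rewrite subUset sub1set sE andbT.
Qed.

Lemma path_edges_mem u s e x : e \in path_edges u s -> x \in e -> x \in u :: s.
Proof.
elim: s u => [|v s IH] u /=; first by rewrite inE.
rewrite inE => /orP[/set1P ->|/IH h].
  by rewrite !inE => /orP[] ->; rewrite ?orbT.
by move/h => xs; rewrite inE xs orbT.
Qed.

Lemma path_edges_vpairs u s : uniq (u :: s) -> path_edges u s \subset vpairs V.
Proof.
elim: s u => [|v s IH] u; first by rewrite sub0set.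
rewrite cons_uniq => /andP[us /IH sE]; rewrite /= subUset sub1set sE andbT pairs_neq.
by apply: contraNneq us => ->; rewrite mem_head.
Qed.

Lemma card_path_edges u s : uniq (u :: s) -> #|path_edges u s| = size s.
Proof.
elim: s u => [|v s IH] u; first by rewrite cards0.
rewrite cons_uniq => /andP[us /IH sE]; rewrite /= cardsU1 sE.
suff -> : [set u; v] \notin path_edges v s by [].
by apply: contra us => /path_edges_mem; apply; rewrite set21.
Qed.

Lemma card_cross_pairs A B : [disjoint A & B] -> #|cross_pairs A B| = #|A| * #|B|.
Proof.
move=> dAB; rewrite /cross_pairs curry_imset2X card_in_imset ?cardsX //.
move=> [a b] [a' b'] /setXP[/= aA bB] /setXP[/= a'A b'B] e.
have nAB x y : x \in A -> y \in B -> (x == y) = false.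
  by move=> xA yB; apply/negP => /eqP xy; rewrite -xy (disjointFr dAB xA) in yB.
have : a \in [set a'; b'] by rewrite -e set21.
rewrite !inE (nAB _ _ aA b'B) orbF => /eqP aa'.
have : b \in [set a'; b'] by rewrite -e set22.
by rewrite !inE eq_sym (nAB _ _ a'A bB) => /eqP ->; rewrite aa'.
Qed.

Lemma cross_pairs_vpairs A B : [disjoint A & B] -> cross_pairs A B \subset vpairs V.
Proof.
move=> dAB; apply/subsetP => e /imset2P[a b aA bB ->]; rewrite pairs_neq.
by apply: contraTneq bB => <-; rewrite (disjointFr dAB aA).
Qed.

Definition pairs_in W : {set {set V}} := [set e in vpairs V | e \subset W].

Lemma pairs_in_vpairs W : pairs_in W \subset vpairs V.
Proof. by rewrite /pairs_in setIdE subsetIl. Qed.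

Lemma card_pairs_in W : 2 * #|pairs_in W| <= #|W| ^ 2.
Proof.
have -> : #|pairs_in W| = 'C(#|W|, 2).
  by rewrite -cards_draws; apply: eq_card => e; rewrite !inE andbC.
by rewrite bin2 -mulnn; have := odd_double_half (#|W| * #|W|.-1); nia.
Qed.

Lemma card_vpairs : 2 * #|vpairs V| <= #|V| ^ 2.
Proof.
rewrite -[#|V|]cardsT; apply: leq_trans (card_pairs_in _).
by rewrite leq_mul2l /=; apply/subset_leq_card/subsetP => e eV; rewrite inE eV subsetT.
Qed.

Lemma setI_pairs_in E W : E \subset vpairs V ->
  E :&: pairs_in W = [set e in E | e \subset W].
Proof.
move=> /subsetP sE; apply/setP => e; rewrite !inE.
by case: (boolP (e \in E)) => // /sE; rewrite inE => ->.
Qed.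

End Pairs.

(** * The random graph *)

Local Open Scope ring_scope.

(** * Expanding products over sets *)

Section Sums.
Variables (R : realType) (T : finType).
Implicit Types (D X : {set T}).

Lemma prod_if_in D X (c : R) : X \subset D ->
  \prod_(e in D) (if e \in X then c else 1) = c ^+ #|X|.
Proof.
move=> sXD; rewrite -big_mkcondr /= -prodr_const; apply: eq_bigl => e.
by apply: andb_idl => /(subsetP sXD).
Qed.

Lemma prodrD_set (F H : T -> R) :
  \prod_e (F e + H e) = \sum_(X : {set T}) \prod_e (if e \in X then F e else H e).
Proof. exact: bigA_distr. Qed.

(** The binomial theorem, summed over subsets. It evaluates the union bounds over vertex sets and
    over edge sets. *)
Lemma sum_expr_card D (q : R) : \sum_(X : {set T} | X \subset D) q ^+ #|X| = (1 + q) ^+ #|D|.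
Proof.
have := prodrD_set (fun e => if e \in D then q else 0) (fun=> 1 : R).
rewrite [X in X = _](eq_bigr (fun e => if e \in D then 1 + q else 1)); last first.
  by move=> e _; case: ifP => _; [rewrite addrC | rewrite add0r].
rewrite -big_mkcond prodr_const => ->; rewrite big_mkcond /=.
apply: eq_bigr => J _; case: ifP => [/subsetP sJ|/negbT/subsetPn[e eJ eD]].
  rewrite -prodr_const [in LHS]big_mkcond /=; apply: eq_bigr => e _.
  by case: ifP => // /sJ ->.
by rewrite (bigD1 e) //= eJ (negPf eD) mul0r.
Qed.

Lemma exprD1_le_expR (t : R) k : 0 <= 1 + t -> (1 + t) ^+ k <= expR (t * k%:R).
Proof.
by move=> t0; rewrite expRM_natr lerXn2r ?nnegrE ?expR_ge0 // expR_ge1Dx.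
Qed.

End Sums.

(** * Independence, union bound and exponential moments *)

Section Gnp.
Variables (R : realType) (n : nat) (p : R).
Hypothesis p01 : 0 <= p <= 1.
Implicit Types (G : sgraph 'I_n) (X Y : {set {set 'I_n}}) (A B C : pred (sgraph 'I_n)).
Local Notation pairs := (vpairs 'I_n).

Lemma gnp_weight_ge0 G : 0 <= gnp_weight p G.
Proof.
have /andP[p0 p1] := p01.
by apply: prodr_ge0 => e _; case: ifP => // _; rewrite subr_ge0.
Qed.

(** Independence of the edges. Expanding the right-hand product gives a sum over all sets of vertex
    sets; those not contained in [pairs] have a zero factor and the others are the graphs. *)
Lemma gnp_expect (a b : {set 'I_n} -> R) :
  \sum_G gnp_weight p G * \prod_(e in pairs) (if e \in edges G then a e else b e)
    = \prod_(e in pairs) (p * a e + (1 - p) * b e).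
Proof.
have := prodrD_set (fun e => if e \in pairs then p * a e else 0)
  (fun e => if e \in pairs then (1 - p) * b e else 1).
rewrite [X in X = _](eq_bigr (fun e => if e \in pairs then
  p * a e + (1 - p) * b e else 1)); last first.
  by move=> e _; case: ifP => // _; rewrite add0r.
rewrite -big_mkcond => ->.
rewrite [RHS](bigID (fun J : {set {set 'I_n}} => J \subset pairs)) /=.
rewrite [X in _ = _ + X]big1 ?addr0; last first.
  move=> J /subsetPn[e eJ eD].
  by rewrite (bigD1 e) //= eJ (negPf eD) mul0r.
rewrite [RHS](reindex_omap (@edges 'I_n) insub) /=; last first.
  by move=> J sJ; rewrite insubT.
apply: eq_big => [G|G _].
  by rewrite (edges_subproof G) /= valK eqxx.
rewrite /gnp_weight -big_split big_mkcond /=; apply: eq_bigr => e _.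
case: ifP => eD; case: ifP => // eG.
by have := subsetP (edges_subproof G) _ eG; rewrite eD.
Qed.

Lemma gnp_total : \sum_(G : sgraph 'I_n) gnp_weight p G = 1.
Proof.
have := gnp_expect (fun=> 1) (fun=> 1).
rewrite [X in _ = X]big1 => [<-|e _]; last by rewrite !mulr1 addrCA subrr addr0.
apply: eq_bigr => G _; rewrite [X in _ * X]big1 ?mulr1 // => e _.
by case: ifP.
Qed.

Lemma gnp_prob_ge0 A : 0 <= gnp_prob p A.
Proof. by apply: sumr_ge0 => G _; apply: gnp_weight_ge0. Qed.

Lemma gnp_probC A : gnp_prob p A = 1 - gnp_prob p (fun G => ~~ A G).
Proof. by rewrite -gnp_total (bigID A) /= addrK. Qed.

Lemma gnp_union (I : finType) (Q : pred I) (A : I -> pred (sgraph 'I_n)) B :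
  (forall G, B G -> exists2 i, Q i & A i G) ->
  gnp_prob p B <= \sum_(i | Q i) gnp_prob p (A i).
Proof.
move=> BA; rewrite /gnp_prob; under [X in _ <= X]eq_bigr => i _ do rewrite big_mkcond.
rewrite exchange_big big_mkcond /=; apply: ler_sum => G _.
have pos i : Q i -> 0 <= (if A i G then gnp_weight p G else 0).
  by move=> _; case: ifP => // _; apply: gnp_weight_ge0.
case: ifP => [/BA[i Qi Ai]|_]; last exact: sumr_ge0.
rewrite (bigD1 i) //= Ai lerDl; apply: sumr_ge0 => j /andP[Qj _].
exact: pos.
Qed.

Lemma gnp_unionU A B C : (forall G, C G -> A G || B G) ->
  gnp_prob p C <= gnp_prob p A + gnp_prob p B.
Proof.
move=> CAB; have := @gnp_union bool predT (fun i => if i then A else B) C.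
rewrite big_bool; apply => G /CAB/orP[AG|BG]; first by exists true.
by exists false.
Qed.

(* Markov's inequality for [theta ^ #|edges G :&: Y|] on the event that [X] is
   contained in [G]; [theta = 0] gives the event that [Y] is avoided. *)
Lemma gnp_markov X Y (theta c : R) A : X \subset pairs -> Y \subset pairs ->
  [disjoint X & Y] -> 0 <= theta ->
  (forall G, A G -> X \subset edges G /\ c <= theta ^+ #|edges G :&: Y|) ->
  gnp_prob p A * c <= p ^+ #|X| * expR (p * (theta - 1) * #|Y|%:R).
Proof.
move=> sX sY dXY t0 AXY; have /andP[p0 p1] := p01.
(* With these factors, [b] vanishing on [X], the product over the pairs is zero unless [X] lies in
   the graph, and is then [theta] to the number of edges in [Y]. *)
pose a e := if e \in Y then theta else 1.
pose b e : R := if e \in X then 0 else 1.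
have val G : X \subset edges G ->
    \prod_(e in pairs) (if e \in edges G then a e else b e)
      = theta ^+ #|edges G :&: Y|.
  move=> sXG; rewrite -(prod_if_in theta (subset_trans (subsetIr _ _) sY)).
  apply: eq_bigr => e _; rewrite inE /a /b; case: (boolP (e \in edges G)) => //= eG.
  by case: ifP => // /(subsetP sXG); rewrite (negPf eG).
apply: (@le_trans _ _ (\sum_G gnp_weight p G *
    \prod_(e in pairs) (if e \in edges G then a e else b e))).
  rewrite /gnp_prob mulr_suml [X in X <= _]big_mkcond; apply: ler_sum => G _.
  case: ifP => [/AXY[sXG cG]|_].
    by rewrite val // ler_wpM2l // gnp_weight_ge0.
  apply: mulr_ge0; first exact: gnp_weight_ge0.
  by apply: prodr_ge0 => e _; rewrite /a /b; do ![case: ifP => //].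
rewrite gnp_expect.
have -> : \prod_(e in pairs) (p * a e + (1 - p) * b e) =
    p ^+ #|X| * (1 + p * (theta - 1)) ^+ #|Y|.
  rewrite -(prod_if_in _ sX) -(prod_if_in _ sY) -big_split /=.
  apply: eq_bigr => e _; rewrite /a /b.
  case: (boolP (e \in X)) => eX; first by rewrite (disjointFr dXY eX) /=; ring.
  by case: ifP => _; ring.
apply: ler_wpM2l; first exact: exprn_ge0.
by apply: exprD1_le_expR; nra.
Qed.

End Gnp.

(** * Lower tails and the minimum degree *)

Section Bounds.
Variables (R : realType) (n : nat) (p : R).
Hypothesis p01 : 0 <= p <= 1.
Implicit Types (G : sgraph 'I_n) (X Y : {set {set 'I_n}}) (A B C : pred (sgraph 'I_n)).
Local Notation pairs := (vpairs 'I_n).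
Local Notation y := (n%:R * p).

(** From [1 + 1 / 6 <= expR (1 / 6)], raised to the sixth power. It yields the coefficient [3 / 5]
    of the lower tail. *)
Lemma expRN1_le : expR (- 1) <= 2 / 5 :> R.
Proof.
rewrite expRN invf_ple ?posrE ?expR_gt0 //; last lra.
have -> : 1 = (1 / 6) * 6%:R :> R by lra.
rewrite expRM_natr; apply: le_trans (_ : (1 + 1 / 6) ^+ 6 <= _); first lra.
by rewrite lerXn2r ?nnegrE ?expR_ge0 ?expR_ge1Dx //; lra.
Qed.

(** A Chernoff bound with the fixed parameter [theta = expR (- 1)], for which
    [1 - theta >= 3 / 5]. *)
Lemma gnp_lower_tail X Y K A : X \subset pairs -> Y \subset pairs -> [disjoint X & Y] ->
  (forall G, A G -> X \subset edges G /\ (#|edges G :&: Y| <= K)%N) ->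
  gnp_prob p A <= p ^+ #|X| * expR (K%:R - 3 / 5 * p * #|Y|%:R).
Proof.
move=> sX sY dXY AXY; have /andP[p0 p1] := p01.
have le : gnp_prob p A * expR (- K%:R)
    <= p ^+ #|X| * expR (p * (expR (- 1) - 1) * #|Y|%:R).
  apply: gnp_markov => // [|G /AXY[-> cY]]; first exact: expR_ge0.
  by split=> //; rewrite -expRM_natr ler_expR mulN1r lerN2 ler_nat.
rewrite -(@ler_pM2r _ (expR (- K%:R))) ?expR_gt0 //; apply: le_trans le _.
rewrite -[X in _ <= X]mulrA -expRD; apply: ler_wpM2l; first exact: exprn_ge0.
rewrite ler_expR; have := expRN1_le; have Y0 := ler0n R #|Y|.
have := mulr_ge0 p0 Y0; nra.
Qed.

Lemma gnp_avoid X Y A : X \subset pairs -> Y \subset pairs -> [disjoint X & Y] ->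
  (forall G, A G -> X \subset edges G /\ edges G :&: Y = set0) ->
  gnp_prob p A <= p ^+ #|X| * expR (- (p * #|Y|%:R)).
Proof.
move=> sX sY dXY AXY.
have : gnp_prob p A * 1 <= p ^+ #|X| * expR (p * (0 - 1) * #|Y|%:R).
  by apply: gnp_markov => // G /AXY[-> ->]; rewrite cards0 expr0.
by rewrite mulr1 sub0r mulrN1 mulNr.
Qed.

(** A vertex [v] of degree below 2 has no neighbour or a single one, [w]. In either case all pairs
    from [v] to the remaining vertices are absent; the at most two vertices left out cost
    [2 * p <= 2] in the exponent. *)
Lemma gnp_min_degree :
  gnp_prob p (fun G => [exists v, degE (edges G) v < 2]%N)
    <= n%:R * (1 + y) * expR (2 - y).
Proof.
have /andP[p0 p1] := p01.
pose low (v : 'I_n) G := (degE (edges G) v < 2)%N.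
apply: (le_trans (gnp_union p01 (Q := predT) (A := low) _) _).
  by move=> G /existsP[v dv]; exists v.
have -> : n%:R * (1 + y) * expR (2 - y) =
    \sum_(v < n) (1 + y) * expR (2 - y).
  by rewrite sumr_const card_ord -mulrA mulr_natl.
apply: ler_sum => v _.
pose none G := edges G :&: star v (~: [set v]) == set0.
pose one w G := ([set v; w] \in edges G) && (edges G :&: star v (~: [set v; w]) == set0).
apply: le_trans (gnp_unionU p01 (A := none)
   (B := fun G => [exists (w | w != v), one w G]) _) _.
  move=> G; rewrite /low /degE ltnS leq_eqVlt ltnS leqn0.
  case/orP => [/cards1P[w Nw]|/eqP/cards0_eq N0].
    have vw : adjE (edges G) v w by have := set11 w; rewrite -Nw inE.
    apply/orP; right; apply/existsP; exists w.
    have vwG : [set v; w] \in edges G := vw.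
    rewrite eq_sym (adjE_neq (edges_subproof G) vw) /one vwG /=.
    apply/eqP/setP => e; rewrite !inE; apply/negP => /andP[eG /imsetP[x]].
    rewrite !inE negb_or => /andP[_ xw] ex; case/negP: xw.
    by rewrite -in_set1 -Nw inE /adjE -ex.
  apply/orP; left; apply/eqP/setP => e; rewrite !inE; apply/negP => /andP[eG /imsetP[x _ ex]].
  by have := in_set0 x; rewrite -N0 inE /adjE -ex eG.
have cn : (#|~: [set v]| = n - 1)%N by have := cardsC [set v]; rewrite cards1 card_ord; lia.
have n1 : (1 <= n)%N by have := ltn_ord v; lia.
have le0 : gnp_prob p none <= expR (2 - y).
  apply: le_trans (gnp_avoid (X := set0) (Y := star v (~: [set v])) _ _ _ _) _.
  - by rewrite sub0set.
  - by apply: star_vpairs; rewrite !inE eqxx.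
  - by rewrite -setI_eq0 set0I.
  - by move=> G /eqP; rewrite sub0set.
  rewrite cards0 expr0 mul1r ler_expR card_star ?inE ?eqxx // cn natrB //; nra.
have le1 : gnp_prob p (fun G => [exists (w | w != v), one w G]) <= y * expR (2 - y).
  apply: le_trans (gnp_union p01 (Q := fun w => w != v) (A := one) _) _.
    by move=> G /existsP[w /andP[]]; exists w.
  have -> : y * expR (2 - y) = \sum_(w < n) p * expR (2 - y).
    by rewrite sumr_const card_ord -mulrA mulr_natl.
  rewrite big_mkcond; apply: ler_sum => w _; case: ifP => [wv|_]; last first.
    by apply: mulr_ge0 => //; apply: expR_ge0.
  have vw : v != w by rewrite eq_sym.
  apply: le_trans (gnp_avoid (X := [set [set v; w]]) (Y := star v (~: [set v; w])) _ _ _ _) _.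
  - by rewrite sub1set pairs_neq.
  - by apply: star_vpairs; rewrite !inE eqxx.
  - rewrite -setI_eq0; apply/eqP/setP => e; rewrite !inE.
    apply/negP => /andP[/eqP -> /imsetP[x]]; rewrite !inE negb_or => /andP[_ xw].
    by move/(set2_injr vw) => e'; rewrite e' eqxx in xw.
  - by move=> G /andP[vwG /eqP]; rewrite sub1set.
  rewrite cards1 expr1 ler_wpM2l // ler_expR card_star ?inE ?eqxx //.
  have -> : (#|~: [set v; w]| = n - 2)%N.
    by have := cardsC [set v; w]; rewrite cards2 vw card_ord; lia.
  have n2 : (2 <= n)%N.
    by have := max_card [set v; w]; rewrite cards2 vw card_ord.
  rewrite natrB //; nra.
by apply: le_trans (lerD le0 le1) _; rewrite mulrDl mul1r.
Qed.

End Bounds.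

(** * Probabilities of the exceptional events *)

Section Events.
Variables (R : realType) (n : nat) (p : R).
Hypothesis p01 : 0 <= p <= 1.
Implicit Types (G : sgraph 'I_n) (X Y : {set {set 'I_n}}) (A B C : pred (sgraph 'I_n)).
Local Notation pairs := (vpairs 'I_n).
Local Notation y := (n%:R * p).

Definition low_path l d (us : 'I_n * l.-tuple 'I_n) G :=
  [&& uniq (us.1 :: us.2), path (adjE (edges G)) us.1 us.2,
    (degE (edges G) us.1 <= 2 * d)%N & (degE (edges G) (last us.1 us.2) <= 2 * d)%N].

(** There are at most [n ^ (l + 1)] paths, each present with probability [p ^ l]. Independently, the
    two disjoint stars from its ends to the vertices off the path contain at most [4 * d] edges;
    their [2 * (n - l - 1)] pairs give the coefficient [6 / 5]. *)
Lemma gnp_low_path l d : (0 < l)%N ->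
  gnp_prob p (fun G => [exists us, @low_path l d us G])
    <= n%:R * y ^+ l * expR (4%:R * d%:R - 6 / 5 * p * (n%:R - l.+1%:R)).
Proof.
move=> l0; have /andP[p0 p1] := p01.
apply: (le_trans (gnp_union p01 (Q := fun us : 'I_n * l.-tuple 'I_n => uniq (us.1 :: us.2))
   (A := @low_path l d) _) _).
  by move=> G /existsP[us us_low]; exists us => //; case/andP: us_low.
have -> : n%:R * y ^+ l = #|{: 'I_n * l.-tuple 'I_n}|%:R * p ^+ l.
  by rewrite card_prod card_tuple card_ord natrM natrX exprMn mulrA.
rewrite -mulrA mulr_natl -sumr_const big_mkcond; apply: ler_sum => -[u s] _ /=.
have pos : 0 <= p ^+ l * expR (4%:R * d%:R - 6 / 5 * p * (n%:R - l.+1%:R)).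
  by apply: mulr_ge0; [apply: exprn_ge0 | apply: expR_ge0].
case: ifP => // us.
have uv : u != last u s.
  case: s us pos => -[|v s] /= ss; first by move: ss l0; case: (l).
  by case/andP => us _ _; apply: contraNneq us => {1}->; apply: mem_last.
have us1 : uniq (u :: s) := us; set v := last u s in uv; set S := ~: [set x in u :: s].
have uS : u \notin S by rewrite !inE eqxx.
have vS : v \notin S by rewrite inE negbK inE mem_last.
have cS : #|S| = (n - l.+1)%N.
  have := cardsC [set x in u :: s]; rewrite card_ord cardsE (card_uniqP us1) /=.
  by rewrite size_tuple -/S; move: #|S| => k <-; rewrite addKn.
have ln : (l.+1 <= n)%N.
  by have := max_card [in u :: s]; rewrite (card_uniqP us1) /= size_tuple card_ord.
have dis : [disjoint star u S & star v S].
  rewrite -setI_eq0; apply/eqP/setP => e; rewrite !inE.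
  apply/negP => /andP[/imsetP[x xS ->] /imsetP[x' x'S e']].
  have : u \in [set v; x'] by rewrite -e' set21.
  rewrite !inE (negPf uv) => /eqP ux'; by rewrite -ux' (negPf uS) in x'S.
have cY : #|star u S :|: star v S| = (2 * (n - l.+1))%N.
  have /eqP -> : #|star u S :|: star v S| == (#|star u S| + #|star v S|)%N.
    by rewrite (eq_leqif (leq_card_setU _ _)).
  by rewrite !card_star // cS addnn mul2n.
apply: (le_trans (gnp_lower_tail (X := path_edges u s) (Y := star u S :|: star v S)
   (K := 4 * d) p01 _ _ _ _) _).
- exact: path_edges_vpairs.
- by rewrite subUset !star_vpairs.
- rewrite -setI_eq0; apply/eqP/setP => e; rewrite !inE; apply/negP => /andP[eP].
  have no x : x \in S -> x \in e -> False.
    by move=> xS /(path_edges_mem eP) xs; rewrite !inE in xS xs; rewrite xs in xS.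
  by case/orP => /imsetP[x xS ex]; apply: (no x) => //; rewrite ex set22.
- move=> G /and4P[_ pus du dv]; split; first exact: path_edges_sub.
  rewrite setIUr; apply: leq_trans (leq_card_setU _ _) _.
  apply: leq_trans (leq_add (card_setI_star _ _ _) (card_setI_star _ _ _)) _.
  by apply: leq_trans (leq_add du dv) _; rewrite -mulnDl.
rewrite card_path_edges // size_tuple cY; apply: ler_wpM2l; first exact: exprn_ge0.
by rewrite ler_expR !natrM natrB //; lra.
Qed.

(** A violation contains a path of 1, 2 or 4 edges between low-degree vertices. The at most five
    vertices on it cost [6 / 5 * p * 5 <= 6] in the exponent. *)
Lemma gnp_not_far d :
  gnp_prob p (fun G => ~~ `[< far_low_degree (edges G) d >])
    <= n%:R * (y + y ^+ 2 + y ^+ 4) * expR (4%:R * d%:R - 6 / 5 * y + 6).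
Proof.
have /andP[p0 p1] := p01.
pose P l G := [exists us, @low_path l d us G].
apply: (le_trans (gnp_unionU p01 (A := P 1%N) (B := fun G => P 2%N G || P 4%N G) _) _).
  move=> G; apply: contraNT; rewrite !negb_or => /and3P[n1 n2 n4].
  apply/asboolP => u v uv du dv.
  have no l (s : l.-tuple 'I_n) : ~~ P l G -> uniq (u :: s) -> last u s = v ->
      path (adjE (edges G)) u s -> False.
    move=> /negP nl us sv pus; apply: nl; apply/existsP; exists (u, s).
    by rewrite /low_path /= in us *; rewrite us pus du sv dv.
  have sG := edges_subproof G; split.
  - apply/negP => auv; apply: (no _ [tuple v]) => //=; last by rewrite auv.
    by rewrite inE uv.
  - move=> w uw wv; apply: (no _ [tuple w; v]) => //=; last by rewrite uw wv.
    by rewrite !inE negb_or uv (adjE_neq sG uw) (adjE_neq sG wv).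
  - move=> a w b us ua aw wb bv; apply: (no _ [tuple a; w; b; v]) => //=.
    by rewrite ua aw wb bv.
apply: (le_trans (lerD (lexx _) (gnp_unionU p01 (A := P 2%N) (B := P 4%N) _)) _) => //.
have bound l : (0 < l <= 4)%N -> gnp_prob p (P l) <=
    n%:R * y ^+ l * expR (4%:R * d%:R - 6 / 5 * y + 6).
  case/andP => l0 l4; apply: (le_trans (gnp_low_path d l0)); apply: ler_wpM2l.
    by rewrite mulr_ge0 ?exprn_ge0 ?mulr_ge0.
  have : l.+1%:R <= 5%:R :> R by rewrite ler_nat.
  by rewrite ler_expR; nra.
have := bound 1%N isT; have := bound 2%N isT; have := bound 4%N isT.
by rewrite expr1 !mulrDr !mulrDl; lra.
Qed.

(** Markov's inequality with [theta = expR L]. For [s = #|W|], the moment contributes at most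
    [y * s] to the exponent and the density threshold [- L * d * s / 12 <= - 3 * y * s]. As
    [s >= 1], the total is at most [- y - y * s]; the second term is summed over [W], the first
    makes the sum tend to 0. *)
Lemma gnp_not_sparse d w (L : R) : 0 <= L -> 36%:R * y <= L * d%:R ->
  w%:R * expR L * p <= 2 * y ->
  gnp_prob p (fun G => ~~ `[< locally_sparse (edges G) d w >])
    <= expR (n%:R * expR (- y) - y).
Proof.
move=> L0 Ld wL; have /andP[p0 p1] := p01; have y0 : 0 <= y by apply: mulr_ge0.
pose dense (W : {set 'I_n}) G :=
  (d * #|W| <= 12 * #|[set e in edges G | e \subset W]|)%N.
apply: (le_trans (gnp_union p01 (Q := fun W : {set 'I_n} => (W != set0) && (#|W| <= w)%N)
   (A := dense) _) _).
  move=> G /negP nsp.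
  have [[W /andP[QW dW]]|no] := pselect (exists W, (W != set0) && (#|W| <= w)%N && dense W G).
    by exists W.
  case: nsp; apply/asboolP => W W0 Ww; rewrite ltnNge; apply/negP => dW.
  by case: no; exists W; rewrite W0 Ww.
apply: (@le_trans _ _ (\sum_(W : {set 'I_n} | W \subset [set: 'I_n])
  expR (- y) * expR (- y) ^+ #|W|)).
  rewrite big_mkcond [X in _ <= X]big_mkcond; apply: ler_sum => W _.
  rewrite subsetT; case: ifP => [/andP[W0 Ww]|_]; last first.
    by apply: mulr_ge0; rewrite ?exprn_ge0 ?expR_ge0.
  have s1 : (1 : R) <= #|W|%:R by rewrite ler1n card_gt0.
  have sw : #|W|%:R <= w%:R :> R by rewrite ler_nat.
  have le : gnp_prob p (dense W) * expR (L * (d%:R * #|W|%:R / 12%:R)) <=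
      p ^+ #|(set0 : {set {set 'I_n}})| * expR (p * (expR L - 1) * #|pairs_in W|%:R).
    apply: gnp_markov => //.
    - by rewrite sub0set.
    - exact: pairs_in_vpairs.
    - by rewrite -setI_eq0 set0I.
    - exact: expR_ge0.
    move=> G; rewrite /dense -(setI_pairs_in _ (edges_subproof G)) -(ler_nat R).
    rewrite sub0set !natrM -expRM_natr ler_expR => dW; split=> //.
    by apply: ler_wpM2l => //; lra.
  rewrite cards0 expr0 mul1r in le.
  rewrite -(@ler_pM2r _ (expR (L * (d%:R * #|W|%:R / 12%:R)))) ?expR_gt0 //.
  apply: le_trans le _; rewrite -expRM_natr -!expRD ler_expR.
  have cP : 2 * #|pairs_in W|%:R <= #|W|%:R ^+ 2 :> R.
    by rewrite -natrX -natrM ler_nat card_pairs_in.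
  have P0 := ler0n R #|pairs_in W|.
  have h1 : p * (expR L - 1) * #|pairs_in W|%:R <= p * expR L * #|pairs_in W|%:R.
    by apply: ler_wpM2r => //; apply: ler_wpM2l => //; lra.
  have h2 : p * expR L * (2 * #|pairs_in W|%:R) <= p * expR L * (#|W|%:R * w%:R).
    apply: ler_wpM2l; first by apply: mulr_ge0 => //; apply: expR_ge0.
    by apply: le_trans cP _; rewrite expr2 ler_wpM2l.
  have h3 : w%:R * expR L * p * #|W|%:R <= 2 * y * #|W|%:R by apply: ler_wpM2r.
  have h4 : 36%:R * y * #|W|%:R <= L * d%:R * #|W|%:R by apply: ler_wpM2r.
  have h5 : y * 1 <= y * #|W|%:R by apply: ler_wpM2l.
  nra.
rewrite -mulr_sumr sum_expr_card cardsT card_ord.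
apply: (@le_trans _ _ (expR (- y) * expR (expR (- y) * n%:R))).
  by rewrite ler_wpM2l ?expR_ge0 // exprD1_le_expR // addr_ge0 ?expR_ge0.
by rewrite -expRD ler_expR; lra.
Qed.

(** Of the at most [4 ^ n] cuts, each relevant one has at least [w * n / 24] pairs, and
    [3 / 5 / 24 = 1 / 40]. *)
Lemma gnp_small_cut w K :
  gnp_prob p (fun G => ~~ `[< large_cuts (edges G) w K >])
    <= 4%:R ^+ n * expR (K%:R - w%:R * y / 40%:R).
Proof.
have /andP[p0 p1] := p01.
pose Q (AB : {set 'I_n} * {set 'I_n}) :=
  [&& [disjoint AB.1 & AB.2], (w < 6 * #|AB.1|)%N & (n <= 4 * #|AB.2|)%N].
pose small (AB : {set 'I_n} * {set 'I_n}) G :=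
  (#|edges G :&: cross_pairs AB.1 AB.2| <= K)%N.
apply: (le_trans (gnp_union p01 (Q := Q) (A := small) _) _).
  move=> G /negP ncut.
  have [[AB /andP[QAB sAB]]|no] := pselect (exists AB, Q AB && small AB G).
    by exists AB.
  case: ncut; apply/asboolP => A B dAB wA nB; rewrite leqNgt; apply/negP => sAB.
  by case: no; exists (A, B); rewrite /Q /small dAB wA /= (ltnW sAB) andbT -{1}(card_ord n).
have -> : 4%:R ^+ n = #|{: {set 'I_n} * {set 'I_n}}|%:R :> R.
  rewrite card_prod -cardsT -powersetT card_powerset cardsT card_ord -expnMn.
  by rewrite natrX.
rewrite mulr_natl -sumr_const big_mkcond; apply: ler_sum => -[A B] _.
case: ifP => [/and3P[/= dAB wA nB]|_]; last exact: expR_ge0.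
apply: (le_trans (gnp_lower_tail (X := set0) (Y := cross_pairs A B) (K := K) p01 _ _ _ _) _).
- by rewrite sub0set.
- exact: cross_pairs_vpairs.
- by rewrite -setI_eq0 set0I.
- by move=> G; rewrite sub0set.
rewrite cards0 expr0 mul1r ler_expR card_cross_pairs //.
have : (w * n <= 24 * (#|A| * #|B|))%N.
  by rewrite -[24%N]/(6 * 4)%N -mulnACA leq_mul // ltnW.
rewrite -(ler_nat R) !natrM => wn.
by have := ler_wpM2l p0 wn; have := mulr_ge0 p0 (mulr_ge0 (ler0n R w) (ler0n R n)); lra.
Qed.

Lemma expR_half_le : expR (1 / 2) <= 2 :> R.
Proof.
rewrite -[expR _]invrK -expRN invf_ple ?posrE ?expR_gt0 //.
by apply: le_trans (expR_ge1Dx _); lra.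
Qed.

(** Markov's inequality with [theta = expR (1 / 2)], for which [theta - 1 <= 1]. *)
Lemma gnp_many_edges (M : R) :
  gnp_prob p (fun G => M <= #|edges G|%:R) <= expR ((n%:R * y - M) / 2).
Proof.
have /andP[p0 p1] := p01.
have le : gnp_prob p (fun G => M <= #|edges G|%:R) * expR (M / 2) <=
    p ^+ #|(set0 : {set {set 'I_n}})| * expR (p * (expR (1 / 2) - 1) * #|pairs|%:R).
  apply: gnp_markov => //.
  - by rewrite sub0set.
  - by rewrite -setI_eq0 set0I.
  - exact: expR_ge0.
  move=> G MG; rewrite sub0set (setIidPl (edges_subproof G)); split=> //.
  by rewrite -expRM_natr ler_expR; lra.
have e2 := expR_half_le.
rewrite cards0 expr0 mul1r in le.
rewrite -(@ler_pM2r _ (expR (M / 2))) ?expR_gt0 //.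
apply: le_trans le _; rewrite -expRD ler_expR.
have cP : 2 * #|pairs|%:R <= n%:R ^+ 2 :> R.
  by rewrite -natrX -natrM ler_nat; have := card_vpairs 'I_n; rewrite card_ord.
have P0 := ler0n R #|pairs|.
have h1 : p * (expR (1 / 2) - 1) * #|pairs|%:R <= p * 1 * #|pairs|%:R.
  by apply: ler_wpM2r => //; apply: ler_wpM2l => //; rewrite lerBlDr.
have h2 : p * (2 * #|pairs|%:R) <= p * n%:R ^+ 2 by apply: ler_wpM2l.
move: P0 h1 h2; clear -p0; move: #|pairs|%:R (expR _ - 1) => N e P0 h1 h2.
lra.
Qed.

(* A union bound over the expanders [E] with at most [m] edges: there
   [p ^ #|E| <= expR (6 * m) * (p * expR (- 6)) ^ #|E|], whose sum over all [E]
   is negligible against the probability of having few boosters. *)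
Lemma gnp_few_boosters m : (8 <= n)%N ->
  gnp_prob p (fun G => ~~ `[< many_boosters (edges G) m >])
    <= expR (n%:R + 6 * m%:R - n%:R * y / 60%:R).
Proof.
move=> n8; have /andP[p0 p1] := p01.
pose Q (E : {set {set 'I_n}}) := [&& E \subset pairs, (#|E| <= m)%N, expander E & ~~ ham E].
pose few (E : {set {set 'I_n}}) G := (E \subset edges G) && (#|edges G :&: boosters E| <= n)%N.
have sB (E : {set {set 'I_n}}) : boosters E \subset pairs.
  by rewrite /boosters setIdE subsetIl.
apply: (le_trans (gnp_union p01 (Q := Q) (A := few) _) _).
  move=> G /negP nboost.
  have [[E /andP[QE fE]]|no] := pselect (exists E, Q E && few E G); first by exists E.
  case: nboost; apply/asboolP => E sE cE xE nham.
  rewrite card_ord leqNgt; apply/negP => fE; case: no; exists E.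
  by rewrite /Q /few (subset_trans sE (edges_subproof G)) cE xE nham sE (ltnW fE).
pose q : R := p * expR (- 6).
(* The lower tail on at least [n ^ 2 / 32] boosters gives [3 / 5 / 32 = 3 / 160]. *)
pose c : R := expR (n%:R - 3 / 160%:R * p * n%:R ^+ 2 + 6 * m%:R).
apply: (@le_trans _ _ (\sum_(E : {set {set 'I_n}} | E \subset pairs) c * q ^+ #|E|)).
  rewrite big_mkcond [X in _ <= X]big_mkcond; apply: ler_sum => E _.
  case: ifP => [/and4P[sE cE xE nham]|_]; last first.
    by case: ifP => // _; rewrite !mulr_ge0 ?exprn_ge0 ?mulr_ge0 ?expR_ge0.
  rewrite sE.
  apply: (le_trans (gnp_lower_tail (X := E) (Y := boosters E) (K := n) p01 _ _ _ _) _) => //.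
  - rewrite -setI_eq0; apply/eqP/setP => e; rewrite !inE.
    by case: (e \in E); rewrite ?andbF.
  - by move=> G /andP.
  rewrite exprMn mulrCA; apply: ler_wpM2l; first exact: exprn_ge0.
  rewrite -expRM_natr -expRD ler_expR.
  have : (n ^ 2 <= 32 * #|boosters E|)%N.
    by have := @card_boosters _ E _ sE xE nham; rewrite card_ord; apply.
  rewrite -(ler_nat R) natrX natrM => cB.
  have cE' : #|E|%:R <= m%:R :> R by rewrite ler_nat.
  by have := ler_wpM2l p0 cB; lra.
rewrite -mulr_sumr sum_expr_card.
have q0 : 0 <= q by rewrite mulr_ge0 ?expR_ge0.
apply: (@le_trans _ _ (c * expR (q * #|pairs|%:R))).
  by rewrite ler_wpM2l ?expR_ge0 // exprD1_le_expR // addr_ge0.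
rewrite -expRD ler_expR.
(* The sum over [E] costs at most [p * n ^ 2 / 480], and [3 / 160 - 1 / 480 = 1 / 60]. *)
have e6 : expR (- 6) <= 1 / 240 :> R.
  have -> : - 6 = - 1 * 6%:R :> R by lra.
  rewrite expRM_natr; apply: le_trans (_ : (2 / 5) ^+ 6 <= _); last lra.
  by rewrite lerXn2r ?nnegrE ?expR_ge0 ?expRN1_le //; lra.
have cP : 2 * #|pairs|%:R <= n%:R ^+ 2 :> R.
  by rewrite -natrX -natrM ler_nat; have := card_vpairs 'I_n; rewrite card_ord.
have h1 : q * (2 * #|pairs|%:R) <= q * n%:R ^+ 2 by apply: ler_wpM2l.
have h2 : p * n%:R ^+ 2 * expR (- 6) <= p * n%:R ^+ 2 * (1 / 240).
  by apply: ler_wpM2l => //; rewrite mulr_ge0 ?exprn_ge0.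
rewrite /q; rewrite /q in h1; move: h1 h2; clear.
by move: (expR (- 6)) #|pairs|%:R => e N h1 h2; lra.
Qed.

End Events.

(** * The failure probability as a sum of six terms *)

Definition resilience_is_min_degree_pred n (G : sgraph 'I_n) : bool :=
  (global_resilience (@hamiltonian 'I_n) G)%:Z == (min_degree G)%:Z - 1.

Lemma resilience_of_good n (G : sgraph 'I_n) d w K a : (8 <= n)%N ->
  (forall v, 2 <= degE (edges G) v)%N ->
  far_low_degree (edges G) d -> locally_sparse (edges G) d w ->
  large_cuts (edges G) w K -> (#|edges G| <= a * (K - n))%N ->
  many_boosters (edges G) (n * (d + 2) + a * (2 * n).+1 + n) ->
  resilience_is_min_degree_pred G.
Proof.
move=> n8 deg2 far sparse cuts cG boost.
have V8 : (8 <= #|'I_n|)%N by rewrite card_ord.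
have d2 : (2 <= min_degree G)%N.
  have [v <-] := @min_degree_attained _ G (leq_trans (isT : 0 < 8)%N V8).
  exact: deg2.
rewrite /resilience_is_min_degree_pred global_resilience_hamiltonian //.
- by rewrite predn_int // (leq_trans _ d2).
- exact: leq_trans V8.
move=> H sH cH.
apply: (resilient_ham (d := d) (w := w) (K := K) (a := a)) => //.
- exact: edges_subproof.
- by move=> v; apply: leq_trans cH (min_degree_leq _ _).
- by rewrite card_ord.
- by rewrite card_ord.
Qed.

(** * Estimates for the six terms *)

Section Tails.
Variable R : realType.
Implicit Types x c : R.

(** The exponential dominates the term of degree [k + 1] of its series. A bound of order [1 / x] is
    enough, so all error terms are brought to this form. *)
Lemma expRN_pow_le k c x : 0 < c -> 0 < x ->
  x ^+ k * expR (- (c * x)) <= k.+1`!%:R / c ^+ k.+1 / x.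
Proof.
move=> c0 x0; have cx0 : 0 < c * x by apply: mulr_gt0.
have lb : (c * x) ^+ k.+1 / k.+1`!%:R <= expR (c * x).
  by apply: le_trans (expR_ge1Dxn k (ltW cx0)); rewrite lerDr.
have f0 : 0 < k.+1`!%:R :> R by rewrite ltr0n fact_gt0.
rewrite expRN -ler_pdivlMr ?invr_gt0 ?expR_gt0 // invrK.
apply: le_trans (ler_wpM2l _ lb); last first.
  by rewrite !divr_ge0 ?exprn_ge0 ?ltW.
rewrite exprMn [x ^+ k.+1]exprS.
have c' : c ^+ k.+1 != 0 by rewrite expf_neq0 ?gt_eqF.
have f' := lt0r_neq0 f0; have x' := lt0r_neq0 x0.
rewrite le_eqVlt; apply/orP; left; apply/eqP.
by field; rewrite f' x' c'.
Qed.

Lemma expRN_le c x : 0 < c -> 0 < x -> expR (- (c * x)) <= c^-1 / x.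
Proof.
by move=> c0 x0; have := expRN_pow_le 0 c0 x0; rewrite expr0 expr1 !mul1r.
Qed.

Lemma expR1_ge2 : 2 <= expR 1 :> R.
Proof. exact: expR_ge1Dx. Qed.

Lemma expr4_le_expR k : 4%:R ^+ k <= expR (2 * k%:R) :> R.
Proof.
rewrite mulrC expRM_natl lerXn2r ?nnegrE ?expR_ge0 //.
rewrite -[2 : R]mulr1 expRM_natl; apply: le_trans (_ : 2 ^+ 2 <= _); first lra.
by rewrite lerXn2r ?nnegrE ?expR_ge0 ?expR1_ge2.
Qed.

Lemma gnp_not_resilient_le n (p L M : R) d w K a (y := n%:R * p)
    (m := (n * (d + 2) + a * (2 * n).+1 + n)%N) :
  0 <= p <= 1 -> (8 <= n)%N -> 0 <= L -> 36%:R * y <= L * d%:R ->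
  w%:R * expR L * p <= 2 * y -> M <= (a * (K - n))%:R ->
  gnp_prob p (fun G : sgraph 'I_n => ~~ resilience_is_min_degree_pred G) <=
    n%:R * (1 + y) * expR (2 - y)
    + (n%:R * (y + y ^+ 2 + y ^+ 4) * expR (4%:R * d%:R - 6 / 5 * y + 6)
    + (expR (n%:R * expR (- y) - y)
    + (4%:R ^+ n * expR (K%:R - w%:R * y / 40%:R)
    + (expR ((n%:R * y - M) / 2)
    + expR (n%:R + 6 * m%:R - n%:R * y / 60%:R))))).
Proof.
move=> p01 n8 L0 Ld wL aM.
pose A1 (G : sgraph 'I_n) := [exists v, degE (edges G) v < 2]%N.
pose A2 (G : sgraph 'I_n) := ~~ `[< far_low_degree (edges G) d >].
pose A3 (G : sgraph 'I_n) := ~~ `[< locally_sparse (edges G) d w >].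
pose A4 (G : sgraph 'I_n) := ~~ `[< large_cuts (edges G) w K >].
pose A5 (G : sgraph 'I_n) := M <= #|edges G|%:R.
pose A6 (G : sgraph 'I_n) := ~~ `[< many_boosters (edges G) m >].
apply: (le_trans (gnp_unionU p01 (A := A1)
  (B := fun G => [|| A2 G, A3 G, A4 G, A5 G | A6 G]) _) _).
  move=> G; apply: contraNT; rewrite !negb_or.
  case/and5P=> n1 /negPn/asboolP far /negPn/asboolP sparse /negPn/asboolP cuts.
  case/andP=> n5 /negPn/asboolP boost.
  apply: (resilience_of_good n8 _ far sparse cuts _ boost).
    move=> v; rewrite leqNgt; apply/negP => v1; case/negP: n1. by apply/existsP; exists v.
  rewrite -(ler_nat R); apply: le_trans aM; apply: ltW.
  by rewrite ltNge.
apply: lerD; first exact: gnp_min_degree.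
apply: (le_trans (gnp_unionU p01 (A := A2)
  (B := fun G => [|| A3 G, A4 G, A5 G | A6 G]) _) _) => //.
apply: lerD; first exact: gnp_not_far.
apply: (le_trans (gnp_unionU p01 (A := A3) (B := fun G => [|| A4 G, A5 G | A6 G]) _) _) => //.
apply: lerD; first exact: (gnp_not_sparse p01 L0).
apply: (le_trans (gnp_unionU p01 (A := A4) (B := fun G => A5 G || A6 G) _) _) => //.
apply: lerD; first exact: gnp_small_cut.
apply: (le_trans (gnp_unionU p01 (A := A5) (B := A6) _) _) => //.
apply: lerD; first exact: gnp_many_edges.
exact: gnp_few_boosters.
Qed.

(* The only place where the exact threshold for [n p] matters. *)
Lemma min_degree_tail (N y om : R) : 0 < N -> 1 <= ln N -> 1 <= om ->
  y = ln N + ln (ln N) + om ->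
  N * (1 + y) * expR (2 - y) <= 8%:R * expR 2 / om.
Proof.
move=> N0 l1 om1 yE; set l := ln N in l1 yE *.
have l0 : 0 < l by lra.
have ll : ln l <= l := ltW (ln_sublinear l0).
have -> : expR (2 - y) = expR 2 * expR (- om) / (N * l).
  have eN : expR l = N := lnK N0; have el : expR (ln l) = l := lnK l0.
  rewrite -[X in _ / (X * _)]eN -[X in _ / (_ * X)]el -!expRD -expRN -expRD yE.
  by congr expR; ring.
have om0 : 0 < om by lra.
have e2 : 0 <= expR 2 :> R by apply: expR_ge0.
have tail : om * expR (- om) <= 2 / om.
  have := expRN_pow_le 1 ltr01 om0; rewrite expr1 mul1r => h.
  by apply: le_trans h _; rewrite expr1n divr1.
have h1 : (1 + y) <= l * (4%:R * om) by rewrite yE; nra.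
have -> : N * (1 + y) * (expR 2 * expR (- om) / (N * l))
    = (1 + y) / l * (expR 2 * expR (- om)).
  by field; rewrite !lt0r_neq0.
apply: (@le_trans _ _ (4%:R * om * (expR 2 * expR (- om)))).
  apply: ler_wpM2r; first by rewrite mulr_ge0 ?expR_ge0.
  by rewrite ler_pdivrMr // mulrC.
have := ler_wpM2l e2 tail; move: (expR 2) (expR (- om)) => e f; clear; lra.
Qed.

End Tails.

Section Assembly.
Variable R : realType.
Implicit Types N y c d k w K m : R.

Lemma expR_le_inv c y (e : R) : 0 < c -> 0 < y -> e <= - (c * y) -> expR e <= c^-1 / y.
Proof. by move=> c0 y0 ey; apply: le_trans (expRN_le c0 y0); rewrite ler_expR. Qed.

Lemma nat_floor (x : R) : 0 <= x -> exists2 m : nat, m%:R <= x & x < m%:R + 1.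
Proof.
by move=> /truncn_itv/andP[m1 m2]; exists (Num.truncn x); rewrite ?natr1.
Qed.

Lemma far_tail N y d : 0 < N -> ln N <= y -> 1 <= y -> d <= y / 2000%:R ->
  N * (y + y ^+ 2 + y ^+ 4) * expR (4%:R * d - 6 / 5 * y + 6)
    <= 3 * expR 6 * (5`!%:R / (1 / 10) ^+ 5) / y.
Proof.
move=> N0 Ny y1 dy; have y0 : 0 < y by lra.
have hN : N <= expR y by rewrite -[leLHS](@lnK R) ?posrE // ler_expR.
have hy : y + y ^+ 2 + y ^+ 4 <= 3 * y ^+ 4.
  have h1 : y <= y ^+ 4 by rewrite -{1}[y]expr1 ler_weXn2l.
  have h2 : y ^+ 2 <= y ^+ 4 by rewrite ler_weXn2l.
  lra.
have yy0 : 0 <= y + y ^+ 2 + y ^+ 4 by rewrite !addr_ge0 ?exprn_ge0 // ltW.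
have c0 : 0 < 1 / 10 :> R by lra.
have tail := expRN_pow_le 4 c0 y0.
apply: (@le_trans _ _ (expR y * (3 * y ^+ 4) * expR (4%:R * d - 6 / 5 * y + 6))).
  by apply: ler_wpM2r; [apply: expR_ge0 | apply: ler_pM => //; apply: ltW].
apply: (@le_trans _ _ (3 * expR 6 * (y ^+ 4 * expR (- (1 / 10 * y))))); last first.
  rewrite -[leRHS]mulrA; apply: ler_wpM2l => //.
  by rewrite mulr_ge0 ?expR_ge0.
have -> : expR y * (3 * y ^+ 4) * expR (4%:R * d - 6 / 5 * y + 6)
    = 3 * y ^+ 4 * (expR y * expR (4%:R * d - 6 / 5 * y + 6)) by ring.
have -> : 3 * expR 6 * (y ^+ 4 * expR (- (1 / 10 * y)))
    = 3 * y ^+ 4 * (expR 6 * expR (- (1 / 10 * y))) by ring.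
apply: ler_wpM2l; first by rewrite mulr_ge0 ?exprn_ge0 // ltW.
by rewrite -!expRD ler_expR; lra.
Qed.

Lemma sparse_tail N y : 0 < N -> ln N <= y -> 0 < y ->
  expR (N * expR (- y) - y) <= expR 1 / y.
Proof.
move=> N0 Ny y0.
have h : N * expR (- y) <= 1.
  rewrite expRN ler_pdivrMr ?expR_gt0 // mul1r.
  by rewrite -[leLHS](@lnK R) ?posrE // ler_expR.
rewrite expRD; apply: ler_pM; rewrite ?expR_ge0 ?ler_expR //.
have := expRN_le ltr01 y0; rewrite mul1r invr1 mul1r; exact.
Qed.

Lemma cut_tail n y k w K : 1 <= n%:R :> R -> 0 < y -> 0 < k -> 2 <= n%:R * k ->
  640%:R <= k * y -> n%:R * k <= w + 1 -> K <= n%:R * k * y / 160%:R ->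
  4%:R ^+ n * expR (K - w * y / 40%:R) <= (k / 320%:R)^-1 / y.
Proof.
move=> n1 y0 k0 nk ky wk Kk.
apply: (@le_trans _ _ (expR (2 * n%:R) * expR (K - w * y / 40%:R))).
  by apply: ler_wpM2r; [apply: expR_ge0 | apply: expr4_le_expR].
rewrite -expRD; apply: expR_le_inv => //; first by apply: divr_gt0 => //; lra.
move: (n%:R : R) n1 nk wk Kk => N N1 Nk wk Kk.
have h1 : N * k / 2 * y <= w * y by apply: ler_wpM2r; lra.
have h2 : N * 640%:R <= N * (k * y) by apply: ler_wpM2l; lra.
have h3 : 1 * (k * y) <= N * (k * y) by apply: ler_wpM2r => //; lra.
lra.
Qed.

Lemma edge_tail N y : 1 <= N -> 0 < y ->
  expR ((N * y - 2 * N * y) / 2) <= (1 / 2)^-1 / y.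
Proof.
move=> N1 y0; apply: expR_le_inv => //; first lra.
have : 1 * y <= N * y by apply: ler_wpM2r => //; lra.
lra.
Qed.

Lemma booster_tail N y m : 1 <= N -> 1000%:R <= y -> m <= N * y / 1000%:R ->
  expR (N + 6 * m - N * y / 60%:R) <= (1 / 200%:R)^-1 / y.
Proof.
move=> N1 y1 my; apply: expR_le_inv => //; try lra.
have h1 : 1 * y <= N * y by apply: ler_wpM2r => //; lra.
have h2 : N * 1000%:R <= N * y by apply: ler_wpM2l => //; lra.
lra.
Qed.

(* [w = n * k] with [k = expR (- L)] is the order up to which sets of vertices
   are sparse; [a] is the inverse of the proportion of all edges that a cut
   between large sets contains. *)
Lemma gnp_not_resilient_inv : exists C Y0 : R, forall n (p om : R),
  0 <= p <= 1 -> (8 <= n)%N -> 1 <= ln (n%:R : R) ->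
  n%:R * p = ln n%:R + ln (ln n%:R) + om -> Y0 <= om -> 1 <= om ->
  gnp_prob p (fun G : sgraph 'I_n => ~~ resilience_is_min_degree_pred G) <= C / om.
Proof.
have [L LE] : exists L : R, L = 36%:R * (40%:R * 100%:R) by eexists.
have L0 : 0 <= L by rewrite LE; lra.
have [k [k0 k1 kE]] : exists k : R, [/\ 0 < k, k <= 1 & k * expR L = 1].
  exists (expR (- L)); rewrite expR_gt0 expR_le1 oppr_le0 L0; split=> //.
  by rewrite expRN mulVf // gt_eqF ?expR_gt0.
have k6 : 0 <= 640%:R / k by rewrite divr_ge0 // ltW.
have [b b1 b2] := nat_floor k6.
have [a aS] : exists a : nat, a%:R = b%:R + 1 :> R by exists b.+1; rewrite natr1.
exists (8%:R * expR 2 + (3 * expR 6 * (5`!%:R / (1 / 10) ^+ 5) + (expR 1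
  + ((k / 320%:R)^-1 + ((1 / 2)^-1 + (1 / 200%:R)^-1))))), (2000%:R * 2000%:R / k).
move=> n p om p01 n8 l1 yE omY om1; have /andP[p0 p1] := p01.
have N8 : 8%:R <= n%:R :> R by rewrite ler_nat.
have ll0 : 0 <= ln (ln n%:R) :> R by rewrite ln_ge0.
have [y yd] : exists y, y = n%:R * p by eexists.
rewrite -yd in yE.
have yN : y <= n%:R by rewrite yd -[leRHS]mulr1 ler_wpM2l.
have omy : om <= y by rewrite yE -[leLHS]add0r lerD2r addr_ge0 // (le_trans ler01).
have ky : 2000%:R * 2000%:R <= k * y.
  by rewrite [leRHS]mulrC -ler_pdivrMr //; apply: le_trans omY omy.
have y1 : 1 <= y := le_trans om1 omy.
have y0 : 0 < y := lt_le_trans ltr01 y1.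
have yk : k * y <= y by rewrite -[leRHS]mul1r ler_wpM2r // ltW.
have Ny : ln n%:R <= y by rewrite yE -addrA lerDl addr_ge0 // (le_trans ler01).
have N1 : 1 <= n%:R :> R by apply: le_trans N8; rewrite ler1n.
have T1 := min_degree_tail (lt_le_trans ltr01 N1) l1 om1 yE.
clear yE ll0 l1 omY.
have nk0 : 0 <= n%:R * k by rewrite mulr_ge0 // ltW.
have nky0 : 0 <= n%:R * k * y by rewrite mulr_ge0 // ltW.
have [d d1 d2] := nat_floor (divr_ge0 (ltW y0) (ler0n R 2000)).
have [w w1 w2] := nat_floor nk0.
have [K K1 K2] := nat_floor (divr_ge0 nky0 (ler0n R 160)).
have nk2 : 2 <= n%:R * k.
  have H : y * k <= n%:R * k by apply: ler_wpM2r => //; apply: ltW.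
  clear -ky yk H; lra.
have nky : n%:R * (2000%:R * 2000%:R) <= n%:R * k * y.
  by rewrite -mulrA ler_wpM2l.
have nK : (n <= K)%N by rewrite -(ler_nat R); clear -nky N1 K2; lra.
have Ld : 36%:R * y <= L * d%:R by rewrite LE; clear -d2 ky yk; lra.
have wL : w%:R * expR L * p <= 2 * y.
  have h1 : w%:R * expR L <= n%:R * k * expR L.
    by apply: ler_wpM2r => //; apply: expR_ge0.
  rewrite -mulrA kE mulr1 in h1.
  have h2 : w%:R * expR L * p <= n%:R * p by apply: ler_wpM2r.
  apply: le_trans h2 _; rewrite -yd; clear -y0; lra.
have aM : 2 * n%:R * y <= (a * (K - n))%:R.
  rewrite natrM natrB //.
  have h1 : n%:R * k * y / 320%:R <= K%:R - n%:R by clear -nky N1 K2; lra.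
  have h2 : 640%:R / k * (n%:R * k * y / 320%:R) <= a%:R * (K%:R - n%:R).
    by apply: ler_pM => //; [rewrite divr_ge0 | rewrite aS ltW].
  apply: le_trans h2; rewrite le_eqVlt; apply/orP; left; apply/eqP.
  by field; rewrite gt_eqF.
have := @gnp_not_resilient_le R n p L (2 * n%:R * y) d w K a p01 n8 L0.
rewrite -yd => /(_ Ld wL aM); set m := (n * (d + 2) + _ + n)%N => main; apply: (le_trans main).
have my : m%:R <= n%:R * y / 1000%:R.
  have a3 : 3 * a%:R + 3 <= y / 2000%:R.
    have h1 : 640%:R / k + 5 <= y / 6000%:R.
      rewrite -lerBrDr ler_pdivrMr // mulrBl; clear -ky k1; lra.
    by clear -h1 aS b1; lra.
  have h2 : n%:R * (3 * a%:R + 3) <= n%:R * (y / 2000%:R) by apply: ler_wpM2l.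
  have h3 : n%:R * d%:R <= n%:R * (y / 2000%:R) by apply: ler_wpM2l.
  have h4 : a%:R * 1 <= a%:R * n%:R :> R by apply: ler_wpM2l.
  rewrite /m !natrD !natrM -natr1 natrM; clear -h2 h3 h4; lra.
have om0 : 0 < om := lt_le_trans ltr01 om1.
have Ce c : 0 <= c -> c / y <= c / om.
  by move=> c0; apply: ler_wpM2l => //; rewrite lef_pV2 ?posrE.
have Ny0 : 0 < n%:R :> R := lt_le_trans ltr01 N1.
have T2 := far_tail Ny0 Ny y1 d1; have T3 := sparse_tail Ny0 Ny y0.
have k640 : 640%:R <= k * y by clear -ky; lra.
have T4 := cut_tail N1 y0 k0 nk2 k640 (ltW w2) K1; have T5 := edge_tail N1 y0.
have y1000 : 1000%:R <= y by clear -ky yk; lra.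
have T6 := booster_tail N1 y1000 my.
rewrite [leRHS]mulrDl; apply: lerD; first exact: T1.
rewrite [leRHS]mulrDl; apply: lerD.
  apply: le_trans T2 (Ce _ _); apply: mulr_ge0; first by rewrite mulr_ge0 ?expR_ge0.
  by apply: divr_ge0; rewrite ?ler0n // exprn_ge0 // divr_ge0.
rewrite [leRHS]mulrDl; apply: lerD.
  by apply: le_trans T3 (Ce _ _); rewrite expR_ge0.
rewrite [leRHS]mulrDl; apply: lerD.
  by apply: le_trans T4 (Ce _ _); rewrite invr_ge0 divr_ge0 // ltW.
rewrite [leRHS]mulrDl; apply: lerD.
  by apply: le_trans T5 (Ce _ _); rewrite invr_ge0 divr_ge0.
by apply: le_trans T6 (Ce _ _); rewrite invr_ge0 divr_ge0.
Qed.

End Assembly.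

From mathcomp Require Import all_classical all_reals all_analysis.
Import numFieldNormedType.Exports.
Local Open Scope classical_set_scope.

Theorem theorem1 (R : realType) (p : nat -> R)
  (p01 : forall n : nat, 0 <= p n <= 1)
  (p_large : n%:R * p n - ln n%:R - ln (ln n%:R) @[n --> \oo] --> +oo) :
  whp p (fun (n : nat) (G : sgraph 'I_n) =>
    (global_resilience (@hamiltonian 'I_n) G)%:Z == (min_degree G)%:Z - 1).
Proof.
have [C [Y0 bound]] := gnp_not_resilient_inv R.
have large : forall A : R, \forall n \near \oo,
    A <= n%:R * p n - ln n%:R - ln (ln n%:R) by apply/cvgryPge.
rewrite /whp; apply/cvgrPdist_le => e e0; near=> n.
set om := n%:R * p n - ln n%:R - ln (ln n%:R).
have n8 : (8 <= n)%N by near: n; exact: nbhs_infty_ge.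
have omY : Y0 <= om by rewrite /om; near: n; apply: large.
have om1 : 1 <= om by rewrite /om; near: n; apply: large.
have omC : C / e <= om by rewrite /om; near: n; apply: large.
have l1 : 1 <= ln (n%:R : R).
  have n0 : 0 < n%:R :> R by rewrite ltr0n (leq_trans _ n8).
  rewrite -ler_expR lnK ?posrE //; apply: (@le_trans _ _ 4%:R); last first.
    by rewrite ler_nat (leq_trans _ n8).
  have -> : expR 1 = expR (1 / 2) ^+ 2 :> R by rewrite -expRM_natl mulrC divfK.
  apply: (@le_trans _ _ (2 ^+ 2)).
    by rewrite lerXn2r ?nnegrE ?expR_ge0 ?expR_half_le.
  by rewrite -natrX.
have yE : n%:R * p n = ln n%:R + ln (ln n%:R) + om by rewrite /om; ring.
have bad := bound n (p n) om (p01 n) n8 l1 yE omY om1.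
rewrite gnp_probC opprB addrCA subrr addr0 ger0_norm; last exact: gnp_prob_ge0.
apply: le_trans bad _.
have om0 : 0 < om := lt_le_trans ltr01 om1.
by rewrite ler_pdivrMr // mulrC -ler_pdivrMr.
Unshelve. all: by end_near.
Qed.
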